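(* Let $\lambda$ be a partition of $n$ and $n=kd$ with $k,d$ positive integers. (1) If there is some $r\in[n]$ such that $d$ does not divide $r\,m_r(\lambda)$, then $\chi^{Q_{\lambda,j}}_{d^k}=0$ for all $0\le j\le n-1$. (2) If $d$ divides $r\,m_r(\lambda)$ for all $r\in[n]$, then \[ \sum_{j=0}^{n-1}\chi^{Q_{\lambda,j}}_{d^k}t^j=\binom{n/d}{\frac{1m_1(\lambda)}{d},\frac{2m_2(\lambda)}{d},\ldots,\frac{nm_n(\lambda)}{d}}\prod_{r=1}^n\sum_{j=0}^{rm_r(\lambda)-1}\chi^{Q_{r^{m_r(\lambda)},j}}_{d^{rm_r(\lambda)/d}}t^j. \]
   Context: $m_r(\lambda)$ is the number of parts of $\lambda$ equal to $r$; $r^m$ denotes the partition with $m$ parts equal to $r$ (the empty partition if $m=0$, for which the corresponding factor is taken to be $1$). ${\rm Exc}(\sigma)=\{i\in[N-1]:i\sigma>i\}$ for $\sigma\in S_N$ acting on the right, ${\rm exc}(\sigma)=|{\rm Exc}(\sigma)|$. For a partition $\lambda$ of $N$, $S_{\lambda,j}$ is the set of $\sigma\in S_N$ of cycle type $\lambda$ with ${\rm exc}(\sigma)=j$. For $\sigma\in S_N$, $w(\sigma)$ is obtained from $\sigma_1\cdots\sigma_N$ ($\sigma_i=i\sigma$) by replacing $\sigma_i$ with $\overline{\sigma_i}$ when $i\in{\rm Exc}(\sigma)$; with letter order $\overline1<\cdots<\overline N<1<\cdots<N$, ${\rm Dex}(\sigma)=\{i\in[N-1]:w_i>w_{i+1}\}$.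 $F_S=\sum x_{j_1}\cdots x_{j_N}$ over $j_1\ge\cdots\ge j_N\ge1$ with $j_i>j_{i+1}$ for $i\in S$. $Q_{\lambda,j}=\sum_{\sigma\in S_{\lambda,j}}F_{{\rm Dex}(\sigma)}$, a homogeneous symmetric function of degree $N$. For such $F$, $\chi^F_\nu$ is defined by $F=\sum_{\nu\vdash N}\chi^F_\nu z_\nu^{-1}{\sf p}_\nu$, with ${\sf p}_\nu$ the power sum and $z_\nu=\prod_ii^{m_i(\nu)}m_i(\nu)!$. *)

(* Defs.v *)
From HB Require Import structures.
From Stdlib Require Import ClassicalEpsilon.
From mathcomp Require Import all_boot all_order all_fingroup all_algebra.
From mathcomp Require Import mpoly.

Set Implicit Arguments.
Unset Strict Implicit.
Unset Printing Implicit Defensive.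

Import Order.TTheory GRing.Theory.

Local Open Scope ring_scope.

Definition is_partn (N : nat) (la : seq nat) : bool :=
  [&& sorted geq la, 0%N \notin la & sumn la == N].

Definition mult (r : nat) (la : seq nat) : nat := count_mem r la.

Definition zpart (nu : seq nat) : nat :=
  (\prod_(1 <= i < (sumn nu).+1) (i ^ mult i nu * (mult i nu)`!))%N.

Definition multinomial_coef (N : nat) (ks : seq nat) : nat :=
  (N`! %/ \prod_(k <- ks) k`!)%N.

(* The set [N] is represented by 'I_N, i.e. shifted to {0, ..., N-1}. Subsets *)
(* of [N-1] are represented as sets of 'I_N: the last element, which has no   *)
(* successor, is never in Exc nor in Dex, and is ignored by Fqsym.            *)
Section Permutations.
Variable N : nat.
Implicit Types s : 'S_N.

Definition cycle_type s : seq nat :=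
  sort geq [seq #|C| | C : {set 'I_N} <- enum (porbits s)].

Definition Exc s : {set 'I_N} := [set i : 'I_N | (i < s i)%N].

Definition exc s : nat := #|Exc s|.

(* A letter is a pair (b, a), barred when b = false; since false < true, the  *)
(* lexicographic order puts the barred letters first.                         *)
Definition wbar s (i : 'I_N) : bool *l 'I_N := (i \notin Exc s, s i).

Definition Dex s : {set 'I_N} :=
  [set i : 'I_N | [exists j : 'I_N,
     (j == i.+1 :> nat) && (wbar s j < wbar s i)%O]].

End Permutations.

(* A formal power series of bounded degree in x_1, x_2, ... is represented by *)
(* the family, indexed by m, of the polynomials obtained from it by setting   *)
(* x_i = 0 for all i > m; the variable x_i is 'X_(i-1).                       *)
Definition series : Type := forall m : nat, {mpoly rat[m]}.

Definition Fqsym (N : nat) (S : {set 'I_N}) : series := fun m =>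
  \sum_(j : {ffun 'I_N -> 'I_m} |
         [forall a : 'I_N, forall b : 'I_N, (b == a.+1 :> nat) ==>
            (j b <= j a)%N && ((a \in S) ==> (j b < j a)%N)])
     \prod_(a < N) 'X_(j a).

Definition Qsym (N : nat) (la : seq nat) (j : nat) : series := fun m =>
  \sum_(s : 'S_N | (cycle_type s == la) && (exc s == j)) Fqsym (Dex s) m.

Definition psum (nu : seq nat) : series := fun m =>
  \prod_(a <- nu) \sum_(i < m) 'X_i ^+ a.

(* c gives the coefficients of the expansion of F in the z_nu^-1 p_nu, for nu *)
(* a partition of N. A partition of N has at most N parts, all at most N, so  *)
(* each one occurs exactly once in the sum.                                   *)
Definition psum_expansion (N : nat) (F : series) (c : seq nat -> rat) : Prop :=
  forall m : nat,
    F m = \sum_(nu : {bseq N of 'I_N.+1} | is_partn N (map val nu))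
            (c (map val nu) / (zpart (map val nu))%:R) *: psum (map val nu) m.

(* The psum nu are linearly independent, so the values at partitions of N of  *)
(* a solution c of psum_expansion N F c are unique.                           *)
Definition chi (N : nat) (F : series) : seq nat -> rat :=
  epsilon (inhabits (fun _ : seq nat => 0 : rat)) (psum_expansion N F).

(* Main.v *)
Require Import Defs.
From Stdlib Require Import ClassicalEpsilon.
From mathcomp Require Import all_boot all_order all_fingroup all_algebra.
From mathcomp Require Import mpoly zify ring.

Set Implicit Arguments.
Unset Strict Implicit.
Unset Printing Implicit Defensive.

Import Order.TTheory GRing.Theory.

(** Put Q_la(t) = sum_j Q_(la,j) t^j.  A monomial of Q_la(t) is a pair
    (sigma, c) of a permutation and a coloring compatible with Dex sigma.  It
    attaches to each point i the periodic word of letters (color, excedance?)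
    read along the sigma-orbit of i.  As in the Gessel-Reutenauer bijection,
    the pair is recovered from the multiset of these words by sorting them
    lexicographically, so that Q_la(t) is a sum over rotation invariant
    multiplicity functions on cyclic words, in which the words of primitive
    period r have total multiplicity r m_r(la).  Sorting the words by period
    gives Q_la = prod_r Q_(r^m_r).

    Newton's identity for complete symmetric functions reduces the expansion of
    Q_(r^m) in power sums to sums over primitive words, hence to sums over all
    closed words, which are the traces of the powers of a matrix X W with
    X = diag(y) and W_ab = q [b <= a] + [a <= b].  Up to a matrix of rank one,
    1 - z X W is triangular in two ways, whence
      (1 - q) det (1 - z X W) = prod_i (1 - z y_i) - q prod_i (1 - z q y_i),
    and Newton's identities express the traces by power sums, with
    coefficients that do not depend on the number of variables.

    Finally, p_(d^k) occurs in a product of power sum expansions only through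
    the terms p_(d^k_r) of the factors, and z_(d^k) = d^k k! produces the
    multinomial coefficient. *)

(** * Cycle types and rotation of words *)

Lemma geq_trans : transitive geq.
Proof. by move=> y x z; rewrite /geq /=; lia. Qed.

Lemma geq_anti : antisymmetric geq.
Proof. by move=> x y /andP[]; rewrite /geq /=; lia. Qed.

Lemma geq_total : total geq.
Proof. by move=> x y; rewrite /geq /=; lia. Qed.

Lemma iter_eq_dvd (T : finType) (s : {perm T}) x k :
  (iter k s x == x) = (#|porbit s x| %| k).
Proof.
set p := #|porbit s x|.
have p0 : 0 < p by rewrite card_gt0; apply/set0Pn; exists x; apply: porbit_id.
have itp q : iter (q * p) s x = x.
  by elim: q => //= q IH; rewrite mulSn iterD IH iter_porbit.
rewrite {1}(divn_eq k p) addnC iterD itp /dvdn.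
have lt : k %% p < p by rewrite ltn_mod.
rewrite -[X in _ == X]/(iter 0 s x).
rewrite -!(nth_traject _ lt) -(nth_traject _ p0).
by rewrite nth_uniq ?size_traject // uniq_traject_porbit.
Qed.

Lemma card_porbit_eq (T T' : finType) (s : {perm T}) (s' : {perm T'}) x y :
  (forall k, (iter k s x == x) = (iter k s' y == y)) ->
  #|porbit s x| = #|porbit s' y|.
Proof.
move=> h; apply/eqP; rewrite eqn_dvd.
by rewrite -{1}iter_eq_dvd h iter_eq_dvd dvdnn -iter_eq_dvd -h iter_eq_dvd /=.
Qed.

Lemma card_porbit_sum (T : finType) (s : {perm T}) r :
  #|[set i | #|porbit s i| == r]| = #|[set C in porbits s | #|C| == r]| * r.
Proof.
rewrite -sum1dep_card (partition_big (porbit s)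
  (mem [set C in porbits s | #|C| == r])) /=; last first.
  by move=> i h; rewrite inE h andbT; apply: imset_f.
rewrite -sum_nat_const; apply: eq_bigr => C; rewrite inE => /andP[].
case/imsetP=> x _ -> /eqP hC; rewrite -[RHS]hC -sum1_card.
apply: eq_bigl => i; rewrite eq_porbit_mem.
case h: (i \in porbit s x); last by rewrite andbF.
by rewrite andbT; move: h; rewrite -eq_porbit_mem => /eqP ->; apply/eqP.
Qed.

Lemma count_cycle_type N (s : 'S_N) r :
  mult r (cycle_type s) = #|[set C in porbits s | #|C| == r]|.
Proof.
rewrite /mult /cycle_type count_sort count_map -size_filter cardE.
rewrite /enum_mem -!filter_predI; congr size; apply: eq_filter => C /=.
by rewrite !inE andbC.
Qed.

(** Points on cycles of length [r] are counted instead of cycles, to match total multiplicities of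
    words. The factor [r] cancels when positive, and length 0 occurs on neither side. *)
Lemma cycle_typeP N (s : 'S_N) la : is_partn N la ->
  reflect (forall r, #|[set i | #|porbit s i| == r]| = (r * mult r la)%N)
          (cycle_type s == la).
Proof.
case/and3P=> sla la0 _; apply: (iffP eqP) => [<- r|h].
  by rewrite card_porbit_sum mulnC count_cycle_type.
have c0 : mult 0 (cycle_type s) = 0.
  rewrite count_cycle_type; apply: eq_card0 => C; rewrite !inE.
  apply/negbTE/negP => /andP[/imsetP[x _ ->]].
  by rewrite cards_eq0 => /eqP e; move: (porbit_id s x); rewrite e inE.
apply: (sorted_eq geq_trans geq_anti) => //; first exact: sort_sorted geq_total _.
apply/allP => r _ /=; apply/eqP.
case: r => [|r]; first by move: c0; rewrite /mult => ->; apply/esym/count_memPn.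
have /eqP := h r.+1; rewrite card_porbit_sum -count_cycle_type mulnC eqn_pmul2l //.
by move/eqP.
Qed.

Lemma digits_lt b l (g : 'I_l -> nat) : 0 < b -> (forall i, g i < b) ->
  \sum_(i < l) g i * b ^ (l.-1 - i) < b ^ l.
Proof.
move=> b0; elim: l g => [|l IH] g gl; first by rewrite big_ord0.
rewrite big_ord_recl /= subn0.
have h : \sum_(i < l) g (lift ord0 i) * b ^ (l - lift ord0 i) < b ^ l.
  rewrite -[X in X < _]/(\sum_(i < l) g (lift ord0 i) * b ^ (l - (1 + i))).
  under eq_bigr do rewrite subnDA subn1.
  exact: (IH (fun i => g (lift ord0 i))).
rewrite expnS; apply: leq_trans (leq_mul (gl ord0) (leqnn (b ^ l))).
by rewrite mulSn addnC ltn_add2r.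
Qed.

Section Words.
Variables (A : finType) (l : nat).
(** In the correspondence [l.+1] is a common multiple of all cycle lengths, so that words of
    different periods live in one finite type. *)
Definition cyclic_word := {ffun 'I_l.+1 -> A}.
Definition shift_fun (w : cyclic_word) : cyclic_word := [ffun i => w (ordS i)].

Lemma shift_fun_inj : injective shift_fun.
Proof.
move=> x y /ffunP e; apply/ffunP => i.
by have := e (ord_pred i); rewrite !ffunE ord_predK.
Qed.

Definition rotation : {perm cyclic_word} := perm shift_fun_inj.
Definition hd (w : cyclic_word) := w ord0.

Lemma shiftE w i : rotation w i = w (ordS i).
Proof. by rewrite permE ffunE. Qed.

Lemma ordS_inZp k : ordS (inZp k : 'I_l.+1) = inZp k.+1.
Proof. by apply: val_inj => /=; rewrite -addn1 modnDml addn1. Qed.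

Lemma iter_shift k w i : iter k rotation w i = w (inZp (i + k)).
Proof.
elim: k i => [|k IH] i; first by rewrite addn0 valZpK.
rewrite iterS shiftE IH; congr (w _); apply: val_inj => /=.
by rewrite modnDml addSnnS.
Qed.

Lemma hd_iter k w : hd (iter k rotation w) = w (inZp k).
Proof. by rewrite /hd iter_shift add0n. Qed.

Lemma word_ext x y :
  (forall k, hd (iter k rotation x) = hd (iter k rotation y)) -> x = y.
Proof.
by move=> h; apply/ffunP => i; have := h i; rewrite !hd_iter valZpK.
Qed.

Lemma iter_shift_size w : iter l.+1 rotation w = w.
Proof.
apply/ffunP => i; rewrite iter_shift; congr (w _); apply: val_inj => /=.
by rewrite modnDr modn_small.
Qed.

Lemma card_porbit_shift w : #|porbit rotation w| %| l.+1.
Proof. by rewrite -iter_eq_dvd iter_shift_size. Qed.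

Definition word_of (h : nat -> A) : cyclic_word := [ffun i : 'I_l.+1 => h i].

Lemma hd_word_of (h : nat -> A) k : (forall k, h (k + l.+1) = h k) ->
  hd (iter k rotation (word_of h)) = h k.
Proof.
move=> hp; rewrite hd_iter ffunE /= {2}(divn_eq k l.+1) addnC.
by elim: (k %/ l.+1) => [|q IH]; rewrite ?addn0 // mulSn addnCA addnC hp.
Qed.

Variables (code : A -> nat) (b : nat).
Hypothesis code_inj : injective code.
Hypothesis code_lt : forall a, code a < b.

(* word_key w is the number with digits code (w i) in base b, so that the order
   on keys is the lexicographic order on words. *)
Definition tail_key (w : cyclic_word) := \sum_(i < l) code (w (lift ord0 i)) * b ^ (l.-1 - i).
Definition word_key (w : cyclic_word) := code (hd w) * b ^ l + tail_key w.

Lemma tail_key_lt w : tail_key w < b ^ l.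
Proof.
by apply: digits_lt => //; apply: leq_ltn_trans (code_lt (hd w)).
Qed.

(** Rotation moves the leading digit to the last place. *)
Lemma key_shift w : word_key (rotation w) = b * tail_key w + code (hd w).
Proof.
have -> : word_key (rotation w) = \sum_(i < l.+1) code (w (ordS i)) * b ^ (l - i).
  rewrite big_ord_recl /= subn0 /word_key /hd shiftE; congr addn.
  apply: eq_bigr => i _; rewrite shiftE /= /bump /=; congr (_ * b ^ _); lia.
rewrite big_ord_recr /= subnn muln1; congr addn; last first.
  congr (code (w _)); apply: val_inj => /=; exact: modnn.
rewrite /tail_key big_distrr; apply: eq_bigr => i _ /=.
have -> : ordS (widen_ord (leqnSn l) i) = lift ord0 i.
  by apply: val_inj; rewrite /= modn_small // ltnS.
rewrite mulnCA -expnS; congr (_ * b ^ _).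
by have := ltn_ord i; lia.
Qed.

Lemma key_hd x y : code (hd x) < code (hd y) -> word_key x < word_key y.
Proof.
move=> h; rewrite /word_key; apply: leq_trans (leq_addr _ _).
apply: leq_trans (leq_mul h (leqnn (b ^ l))).
by rewrite mulSn addnC ltn_add2r tail_key_lt.
Qed.

(** The digit that moves is the same in both words, so it affects neither comparison. *)
Lemma key_shift_lt x y : hd x = hd y ->
  (word_key (rotation x) < word_key (rotation y)) = (word_key x < word_key y).
Proof.
have b0 : 0 < b by apply: leq_ltn_trans (code_lt (hd x)).
move=> e; rewrite !key_shift /word_key e ltn_add2r ltn_add2l ltn_mul2l b0 //.
Qed.

Lemma key_hd_le x y : word_key x <= word_key y -> code (hd x) <= code (hd y).
Proof.
by move=> h; rewrite leqNgt; apply/negP => /key_hd k; move: h; rewrite leqNgt k.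
Qed.

(** Equal keys force equal heads, and then equal keys of the rotations, so all letters agree in
    turn. *)
Lemma key_inj : injective word_key.
Proof.
have hdE x y : word_key x = word_key y -> hd x = hd y.
  by move=> e; apply: code_inj; apply/eqP; rewrite eqn_leq !key_hd_le // e.
have shE x y : word_key x = word_key y -> word_key (rotation x) = word_key (rotation y).
  move=> e; have h := hdE _ _ e.
  apply/eqP; rewrite eqn_leq leqNgt (key_shift_lt (esym h)) e ltnn /=.
  by rewrite leqNgt (key_shift_lt h) e ltnn.
move=> x y e; apply: word_ext => k.
apply: hdE; elim: k => [|k IH]; [exact: e | exact: shE IH].
Qed.

End Words.

(** * The Gessel-Reutenauer correspondence *)

Section Rank.
Variables (N : nat) (T : eqType) (u : 'I_N -> T).

(** The position of [i] among the points carrying the same word; it tells such points apart when a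
    permutation is rebuilt from its words. *)
Definition rank (i : 'I_N) := #|[set j : 'I_N | (j < i) && (u j == u i)]|.

Lemma rank_lt i j : u i = u j -> i < j -> rank i < rank j.
Proof.
move=> e lij; apply: proper_card; apply/properP; split.
  by apply/subsetP => k; rewrite !inE e => /andP[h ->]; rewrite (ltn_trans h).
by exists i; rewrite !inE ?e ?lij ?eqxx // ltnn.
Qed.

Lemma rank_ltE i j : u i = u j -> (i < j) = (rank i < rank j).
Proof.
move=> e; case: (ltngtP i j) => [h|h|/val_inj ->]; first by rewrite rank_lt.
  by have := rank_lt (esym e) h; lia.
by rewrite ltnn.
Qed.

Lemma rank_inj i j : u i = u j -> rank i = rank j -> i = j.
Proof.
move=> e r; apply: val_inj; case: (ltngtP i j) => // h.
  by have := rank_lt e h; rewrite r ltnn.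
by have := rank_lt (esym e) h; rewrite r ltnn.
Qed.

Lemma rank_bound i : rank i < #|[set j | u j == u i]|.
Proof.
apply: proper_card; apply/properP; split.
  by apply/subsetP => k; rewrite !inE => /andP[].
by exists i; rewrite !inE ?eqxx // ltnn.
Qed.

(** Ranks inside a class are distinct and below its cardinality, so they fill the whole interval. *)
Lemma rank_ex w k : k < #|[set j | u j == w]| -> exists2 i, u i = w & rank i = k.
Proof.
move=> lk; set I := [set j | u j == w] in lk.
have uI i : i \in enum I -> u i = w by rewrite mem_enum inE => /eqP.
have un : uniq (map rank (enum I)).
  rewrite map_inj_in_uniq ?enum_uniq // => i j /uI ei /uI ej.
  by apply: rank_inj; rewrite ei ej.
have sub : {subset map rank (enum I) <= iota 0 #|I|}.
  move=> x /mapP[i /uI ei ->]; rewrite mem_iota add0n /=.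
  by have := rank_bound i; rewrite ei.
have [//|_ eqi] := uniq_min_size un sub; first by rewrite size_iota size_map -cardE.
have : k \in map rank (enum I) by rewrite eqi mem_iota.
by case/mapP=> i /uI ei ->; exists i.
Qed.

End Rank.

Section Equivariant.
Variables (N : nat) (T : finType) (rho : {perm T}).
Variables (u : 'I_N -> T) (s : 'S_N).
Hypothesis u_s : forall i, u (s i) = rho (u i).
Hypothesis s_mono : forall i j, u i = u j -> i < j -> s i < s j.

Lemma u_iter k i : u (iter k s i) = iter k rho (u i).
Proof. by elim: k => //= k IH; rewrite u_s IH. Qed.

Lemma s_mono_iter k i j : u i = u j -> i < j -> iter k s i < iter k s j.
Proof.
move=> e lij; elim: k => //= k IH; apply: s_mono => //.
by rewrite !u_iter e.
Qed.

Lemma no_increasing_iter (i : 'I_N) k :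
  ~ (forall n, iter (n * k) s i < iter (n.+1 * k) s i).
Proof.
move=> h; have le n : n <= iter (n * k) s i.
  by elim: n => // n IH; apply: leq_ltn_trans IH _.
by have := le N; rewrite leqNgt ltn_ord.
Qed.

Lemma no_decreasing_iter (i : 'I_N) k :
  ~ (forall n, iter (n.+1 * k) s i < iter (n * k) s i).
Proof.
move=> h; have le n : n + iter (n * k) s i <= i.
  elim: n => // n IH; apply: leq_trans _ IH.
  by rewrite addSnnS leq_add2l.
by have := le i.+1; lia.
Qed.

(* If s^k i <> i carried the same word as i, then s^k would move the points
   s^(nk) i always in the same direction: the word of i has primitive period
   equal to the length of the cycle of i. *)
Lemma iter_fix k i : (iter k s i == i) = (iter k rho (u i) == u i).
Proof.
apply/eqP/eqP => [h|]; first by rewrite -u_iter h.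
rewrite -u_iter => e; apply: val_inj.
have ei n : u (iter (n * k) s i) = u i.
  by elim: n => //= n IH; rewrite mulSn iterD u_iter IH -u_iter.
case: (ltngtP (iter k s i) i) => // h; exfalso.
  apply: (@no_decreasing_iter i k) => n.
  by rewrite mulSn addnC iterD; apply: s_mono_iter.
apply: (@no_increasing_iter i k) => n.
by rewrite mulSn addnC iterD; apply: s_mono_iter.
Qed.

Lemma card_porbit_u i : #|porbit s i| = #|porbit rho (u i)|.
Proof. by apply: card_porbit_eq => k; apply: iter_fix. Qed.

Lemma s_monoE i j : u i = u j -> (s i < s j) = (i < j).
Proof.
move=> e; case: (ltngtP i j) => [h|h|/val_inj ->]; first by rewrite s_mono.
  by have := s_mono (esym e) h; lia.
by rewrite ltnn.
Qed.

(** On a class of equal words [s] is an increasing bijection onto the class of the image word, so it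
    preserves positions. *)
Lemma rank_s i : rank u (s i) = rank u i.
Proof.
rewrite /rank -[RHS](card_imset _ (@perm_inj _ s)); apply: eq_card => j.
apply/idP/imsetP => [|[k]]; rewrite !inE.
  case/andP=> lt /eqP e; have ej : j = s (s^-1%g j) by rewrite permKV.
  exists (s^-1%g j) => //; rewrite !inE.
  have e' : u (s^-1%g j) = u i by apply: (@perm_inj _ rho); rewrite -!u_s -ej.
  by rewrite e' eqxx andbT -s_monoE // -ej.
by case/andP=> lt /eqP e -> ; rewrite s_monoE // lt !u_s e eqxx.
Qed.

Lemma sum_card_porbit (P : pred nat) :
  #|[set i | P #|porbit s i|]| =
  \sum_(w | P #|porbit rho w|) #|[set i | u i == w]|.
Proof.
rewrite -sum1dep_card (partition_big u (fun w => P #|porbit rho w|)) /=; last first.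
  by move=> i; rewrite card_porbit_u.
apply: eq_bigr => w Pw; rewrite -sum1dep_card; apply: eq_bigl => i.
by rewrite card_porbit_u; case: eqP => [->|]; rewrite ?Pw ?andbF.
Qed.

End Equivariant.

(** * Letters, admissible words and the meaning of bars *)

Section Letters.
Variable m : nat.
Definition letter := ('I_m * bool)%type.
Implicit Types a b : letter.

(* A letter (a, b) has color a and is barred when b = true.  Larger colors come
   first and, within a color, barred letters come first. *)
Definition code a := ((m - a.1).*2 + ~~ a.2)%N.
(** An excedance leads to a larger index, where the color is weakly smaller; any other point leads
    to an index that is not larger, where the color is weakly larger. *)
Definition step a b := if a.2 then b.1 <= a.1 else a.1 <= b.1.

Lemma code_inj : injective code.
Proof.
case=> [i x] [j y]; rewrite /code /= => h.
have hi := ltn_ord i; have hj := ltn_ord j.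
have e : i = j by apply: val_inj => /=; case: x y h => [] [] /=; lia.
by rewrite e in h *; congr pair; case: x y h => [] [] //=; lia.
Qed.

Lemma code_lt a : code a < m.*2.+2.
Proof. by case: a => i [] /=; rewrite /code /=; lia. Qed.

Lemma code_le_color a b : code a <= code b -> b.1 <= a.1.
Proof.
case: a b => [i x] [j y]; rewrite /code /=.
have hi := ltn_ord i; have hj := ltn_ord j.
by case: x y => [] [] /=; lia.
Qed.

(** When the colors agree the bars differ, and the barred letter has the smaller code. *)
Lemma step_code a b : step a b -> a <> b ->
  if a.2 then code a < code b else code b < code a.
Proof.
case: a b => [i x] [j y]; rewrite /code /step /= => h ne.
have hi := ltn_ord i; have hj := ltn_ord j.
have ne' : (i : nat) <> j \/ x <> y.
  case: (eqVneq (i : nat) j) => [/val_inj ei|/eqP]; [right|by left].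
  by move=> ex; apply: ne; rewrite ei ex.
by case: x y h ne' {ne} => [] [] /= h [] // ; lia.
Qed.

Variable l : nat.
Notation word := (cyclic_word letter l).
Notation shift := (rotation letter l).
Notation key := (@word_key letter l code m.*2.+2).

(* An all-barred word satisfying the step condition is constant, and would
   describe a fixed point that is an excedance. *)
Definition adm (w : word) :=
  [forall i, step (w i) (w (ordS i))] && [exists i, ~~ (w i).2].

Lemma admP (w : word) :
  reflect ((forall k, step (hd (iter k shift w)) (hd (iter k.+1 shift w))) /\
           exists k, ~~ (hd (iter k shift w)).2) (adm w).
Proof.
apply: (iffP andP) => [[/forallP h /existsP [i hi]]|[h [k hk]]]; split.
- by move=> k; have := h (inZp k); rewrite !hd_iter ordS_inZp.
- by exists i; rewrite hd_iter valZpK.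
- by apply/forallP => i; have := h i; rewrite !hd_iter -ordS_inZp valZpK.
by apply/existsP; exists (inZp k); rewrite -hd_iter.
Qed.

Lemma adm_shift (w : word) : adm w -> adm (shift w).
Proof.
case/andP=> /forallP h1 /existsP[i hi]; apply/andP; split.
  by apply/forallP => k; rewrite !shiftE.
by apply/existsP; exists (ord_pred i); rewrite shiftE ord_predK.
Qed.

(** As long as the heads of the two words agree, rotating both preserves their comparison. *)
Lemma key_run k (w : word) :
  (forall j, j < k -> hd (iter j shift w) = hd (iter j.+1 shift w)) ->
  (key (iter k shift w) < key (iter k.+1 shift w)) = (key w < key (shift w)).
Proof.
elim: k => // k IH h; rewrite -IH => [|j lj]; last by apply: h; apply: ltnW.
exact: (key_shift_lt code_lt (h k (ltnSn k))).
Qed.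

(* The comparison is decided at the first letter that differs from hd w. *)
Lemma adm_bar (w : word) : adm w -> (key w < key (shift w)) = (hd w).2.
Proof.
case/admP=> hs [ku hku].
(* A constant word equals its rotation, and admissibility makes its letter unbarred. *)
have [/existsP[i wi]|/existsPn con] := boolP [exists i, w i != hd w]; last first.
  have cst k : hd (iter k shift w) = hd w.
    by rewrite hd_iter; apply/eqP; have := con (inZp k); rewrite negbK.
  have -> : shift w = w by apply: word_ext => k; rewrite -iterSr !cst.
  by rewrite ltnn; move: hku; rewrite cst; case: (_).2.
have ex : exists k, hd (iter k shift w) != hd w by exists i; rewrite hd_iter valZpK.
case: (ex_minnP ex) => -[|k]; first by rewrite eqxx.
move=> nek mink.
have eqk j : j <= k -> hd (iter j shift w) = hd w.
  by move=> lj; apply/eqP/negPn/negP => /mink; lia.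
rewrite -(@key_run k) => [|j lj]; last by rewrite !eqk // ltnW.
have := step_code (hs k); rewrite eqk // => /(_ (fun e => negP nek (introT eqP (esym e)))).
case: (hd w).2 => h; first by apply: key_hd => //; [apply: code_lt | rewrite (eqk k)].
have : key (iter k.+1 shift w) < key (iter k shift w).
  by apply: key_hd => //; [apply: code_lt | rewrite (eqk k)].
by move=> h'; apply/negbTE; rewrite -leqNgt ltnW.
Qed.

End Letters.

Section Compat.
Variables (m N : nat).
Implicit Types (s : 'S_N) (c : {ffun 'I_N -> 'I_m}).

(* The condition on the index of summation in Fqsym (Dex s) m. *)
Definition compat s c :=
  [forall a : 'I_N, forall b : 'I_N, (b == a.+1 :> nat) ==>
     (c b <= c a)%N && ((a \in Dex s) ==> (c b < c a)%N)].

Definition lett s c (i : 'I_N) : letter m := (c i, i < s i).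

(** Lexicographic key made of the letter and then of the image; compatible colorings are exactly
    those along which it increases. *)
Definition kappa s c i := (code (lett s c i) * N + s i)%N.

Lemma kappa_lt s c a b : (kappa s c a < kappa s c b) =
  (code (lett s c a) < code (lett s c b)) ||
  ((code (lett s c a) == code (lett s c b)) && (s a < s b)).
Proof.
rewrite /kappa; have ha := ltn_ord (s a); have hb := ltn_ord (s b).
case: (ltngtP (code (lett s c a)) (code (lett s c b))) => [h|h|->] /=.
- apply: leq_trans (leq_addr _ _); apply: leq_trans (leq_mul h (leqnn N)).
  by rewrite mulSn addnC ltn_add2r.
- apply/negbTE; rewrite -leqNgt ltnW //.
  apply: leq_trans (leq_addr _ _); apply: leq_trans (leq_mul h (leqnn N)).
  by rewrite mulSn addnC ltn_add2r.
by rewrite ltn_add2l.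
Qed.

Lemma Dex_next s (a b : 'I_N) : b = a.+1 :> nat ->
  (a \in Dex s) = (wbar s b < wbar s a)%O.
Proof.
move=> e; rewrite inE; apply/existsP/idP => [[x /andP[/eqP ex]]|h].
  by have -> : x = b by apply: val_inj; rewrite /= ex e.
by exists b; rewrite e eqxx.
Qed.

(** If the color drops, both sides hold. If it stays the same, bar and image compare as in [wbar],
    so an increase of [kappa] says that [a] is not in [Dex s]. *)
Lemma kappa_next s c (a b : 'I_N) : b = a.+1 :> nat ->
  (c b <= c a)%N && ((a \in Dex s) ==> (c b < c a)%N) = (kappa s c a < kappa s c b).
Proof.
move=> e; rewrite kappa_lt (Dex_next s e) /wbar ltEprodlexi /= !inE.
have ne : (s a : nat) <> s b.
  by move/val_inj/perm_inj => eab; rewrite eab in e; lia.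
rewrite ltEord !leEbool /lett /code /=.
have ha := ltn_ord (c a); have hb := ltn_ord (c b).
move: (c a) (c b) (s a) (s b) ha hb ne => x y p q ha hb ne.
case: (b < q); case: (a < p) => /=; rewrite ?lexx /=; try lia.
Qed.

Lemma compatP s c : reflect (forall a b : 'I_N, a < b -> kappa s c a < kappa s c b)
  (compat s c).
Proof.
apply: (iffP forallP) => [h a b|h a]; last first.
  apply/forallP => b; apply/implyP => /eqP e.
  by rewrite kappa_next // h // e.
have hn (x y : 'I_N) : y = x.+1 :> nat -> kappa s c x < kappa s c y.
  by move=> e; rewrite -kappa_next //; have /forallP/(_ y) := h x; rewrite e eqxx.
case: b => b; elim: b => // b IH hb /=; rewrite ltnS leq_eqVlt.
have hb' := ltnW hb.
have step : kappa s c (Ordinal hb') < kappa s c (Ordinal hb) by apply: hn.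
case/orP => [/eqP e|/(IH hb') h']; last exact: ltn_trans h' step.
by have -> : a = Ordinal hb' by apply: val_inj.
Qed.

End Compat.

Section Bijection.
Variables (m l N : nat).
Notation letter := (letter m).
Notation word := (cyclic_word letter l).
Notation shift := (rotation letter l).
Notation key := (@word_key letter l (@code m) m.*2.+2).

Section Direct.
Variables (s : 'S_N) (c : {ffun 'I_N -> 'I_m}).
Hypothesis cpt : compat s c.
Hypothesis dvd_l : forall i, #|porbit s i| %| l.+1.

Definition cycle_word i : word := word_of l (fun k => lett s c (iter k s i)).
Notation u := cycle_word.

Lemma hd_cycle_word k i : hd (iter k shift (u i)) = lett s c (iter k s i).
Proof.
apply: hd_word_of => j; rewrite iterD; congr (lett s c (iter j s _)).
by apply/eqP; rewrite iter_eq_dvd.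
Qed.

Lemma cycle_word_s i : u (s i) = shift (u i).
Proof. by apply: word_ext => k; rewrite -iterSr !hd_cycle_word -iterSr. Qed.

(** Equal words start with the same letter, so the increase of [kappa] is decided by the images. *)
Lemma cycle_word_mono i j : u i = u j -> i < j -> s i < s j.
Proof.
move=> e /(compatP _ _ cpt); rewrite kappa_lt.
by have := hd_cycle_word 0 i; have := hd_cycle_word 0 j; rewrite e /= => -> ->; rewrite ltnn eqxx.
Qed.

(** If the keys were inverted, monotonicity of [kappa] would make the first letters agree and keep
    the images in order, and the keys of the rotations would be inverted again. By induction all
    letters agree, so the words are equal, a contradiction. *)
Lemma key_cycle_word_mono (i j : 'I_N) : i < j -> key (u i) <= key (u j).
Proof.
move=> lij; rewrite leqNgt; apply/negP => kij.
have H k : (iter k s i < iter k s j) && (key (u (iter k s j)) < key (u (iter k s i)))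
   && (lett s c (iter k s i) == lett s c (iter k s j)).
  have aux (x y : 'I_N) : x < y -> key (u y) < key (u x) ->
      (lett s c x == lett s c y) && (s x < s y).
    move=> lxy kxy; have := compatP _ _ cpt _ _ lxy; rewrite kappa_lt.
    have := key_hd_le (@code_lt m) (ltnW kxy).
    rewrite -[u x]/(iter 0 shift (u x)) -[u y]/(iter 0 shift (u y)) !hd_cycle_word /=.
    rewrite leqNgt => /negbTE -> /= /andP[/eqP e ->].
    by rewrite (code_inj e) eqxx.
  elim: k => [|k /andP[/andP[h1 h2] h3]] /=.
    by rewrite lij kij; case/andP: (aux _ _ lij kij).
  have [_ lt] := andP (aux _ _ h1 h2).
  have kk : key (u (s (iter k s j))) < key (u (s (iter k s i))).
    rewrite !cycle_word_s key_shift_lt //; first exact: code_lt.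
    rewrite -[u (iter k s i)]/(iter 0 shift (u (iter k s i))).
    rewrite -[u (iter k s j)]/(iter 0 shift (u (iter k s j))) !hd_cycle_word /=.
    by rewrite (eqP h3).
  by rewrite lt kk; case/andP: (aux _ _ lt kk).
have e : u i = u j.
  by apply: word_ext => k; rewrite !hd_cycle_word; case/andP: (H k) => _ /eqP.
by rewrite e ltnn in kij.
Qed.

Lemma adm_cycle_word i : adm (u i).
Proof.
apply/admP; split=> [k|].
  rewrite !hd_cycle_word iterS; move: (iter k s i) => x.
  have aux (a b : 'I_N) : a < b -> c b <= c a.
    move/(compatP _ _ cpt); rewrite kappa_lt => h.
    apply: (@code_le_color m (lett s c a) (lett s c b)).
    by case/orP: h => [/ltnW//|/andP[/eqP ->]].
  rewrite /step /lett /=; case: (ltngtP x (s x)) => // h; try exact: aux.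
  by have -> : s x = x by apply: val_inj.
pose b := [exists k : 'I_l.+1, ~~ (u i k).2].
have [/existsP[k hk]|/existsPn h] := boolP b; first by exists k; rewrite hd_iter valZpK.
(* An all-barred word would make the orbit of [i] increase forever. *)
exfalso; apply: (@no_increasing_iter N s i 1) => n; rewrite !muln1 /=.
have := h (inZp n); rewrite -hd_iter hd_cycle_word negbK /=.
by [].
Qed.

End Direct.

Lemma sorted_key_map (u : 'I_N -> word) :
  (forall i j : 'I_N, i < j -> key (u i) <= key (u j)) ->
  sorted (relpre key leq) [seq u i | i <- enum 'I_N].
Proof.
move=> h; rewrite sorted_map.
apply: (@sub_sorted _ (relpre val ltn)) => [i j /= /h //|].
by rewrite -sorted_map val_enum_ord iota_ltn_sorted.
Qed.

Lemma count_map_card (u : 'I_N -> word) w :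
  count_mem w [seq u i | i <- enum 'I_N] = #|[set i | u i == w]|.
Proof.
rewrite count_map -size_filter cardE /enum_mem -!filter_predI; congr size.
by apply: eq_filter => i /=; rewrite !inE andbT.
Qed.

(** Both families of words are the sorted arrangement of one multiset, hence equal. Their heads give
    the coloring; the image of [i] is the point carrying the rotated word with the rank of [i]. *)
Lemma cycle_word_inj s c s' c' :
  compat s c -> (forall i, #|porbit s i| %| l.+1) ->
  compat s' c' -> (forall i, #|porbit s' i| %| l.+1) ->
  (forall w, #|[set i | cycle_word s c i == w]| = #|[set i | cycle_word s' c' i == w]|) ->
  s = s' /\ c = c'.
Proof.
move=> cp dv cp' dv' hw.
have eu : cycle_word s c =1 cycle_word s' c'.
  have e : [seq cycle_word s c i | i <- enum 'I_N] = [seq cycle_word s' c' i | i <- enum 'I_N].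
    apply: (@sorted_eq _ (relpre key leq)).
    - by move=> x y z /=; apply: leq_trans.
    - by move=> x y /= h; apply: (key_inj (@code_inj m) (@code_lt m)); apply/eqP; rewrite eqn_leq.
    - by apply: sorted_key_map; apply: key_cycle_word_mono.
    - by apply: sorted_key_map; apply: key_cycle_word_mono.
    by apply/allP => w _ /=; rewrite !count_map_card hw.
  by move=> i; have /eq_in_map/(_ i) := e; apply; rewrite mem_enum.
have el i : lett s c i = lett s' c' i.
  by have := hd_cycle_word c dv 0 i; rewrite /= eu (hd_cycle_word c' dv' 0) /= => ->.
split; last by apply/ffunP => i; have [] := el i.
apply/permP => i; apply: (@rank_inj _ _ (cycle_word s c)).
  by rewrite cycle_word_s // !eu cycle_word_s.
rewrite (rank_s (cycle_word_s c dv) (cycle_word_mono cp dv)).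
have rE x : rank (cycle_word s c) x = rank (cycle_word s' c') x.
  by apply: eq_card => k; rewrite !inE !eu.
by rewrite !rE (rank_s (cycle_word_s c' dv') (cycle_word_mono cp' dv')).
Qed.

End Bijection.

Lemma sumn_mult K la : (forall r, r \in la -> r < K) ->
  \sum_(r < K) r * mult r la = sumn la.
Proof.
rewrite /mult; elim: la => [|a la IH] h /=; first by rewrite big1 // => r; rewrite muln0.
under eq_bigr do rewrite mulnDr; rewrite big_split /= IH; last first.
  by move=> r hr; apply: h; rewrite inE hr orbT.
congr addn; have ha : a < K by apply: h; rewrite inE eqxx.
rewrite (bigD1 (Ordinal ha)) //= eqxx muln1 big1 ?addn0 // => r.
rewrite -val_eqE /= => /negbTE; rewrite eq_sym => ->; exact: muln0.
Qed.

Section Surj.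
Variables (m l N : nat).
Notation letter := (letter m).
Notation word := (cyclic_word letter l).
Notation shift := (rotation letter l).
Notation key := (@word_key letter l (@code m) m.*2.+2).

(** The words are listed in key order with multiplicity [f], and [s] sends [i] to the point of the
    same rank in the class of the rotated word. That point exists because [f] is rotation
    invariant. *)
Lemma cycle_word_surj (f : word -> nat) :
  (forall w, f (shift w) = f w) -> (forall w, 0 < f w -> adm w) ->
  \sum_w f w = N ->
  exists s : 'S_N, exists c : {ffun 'I_N -> 'I_m},
    [/\ compat s c, (forall i, #|porbit s i| %| l.+1) &
        forall w, #|[set i | cycle_word l s c i == w]| = f w].
Proof.
move=> finv fadm fsum.
pose s0 := flatten [seq nseq (f w) w | w <- enum word].
pose ws := sort (relpre key leq) s0.
have cs0 w : count_mem w ws = f w.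
  rewrite count_sort count_flatten -map_comp sumnE big_map big_enum /=.
  rewrite (bigD1 w) //= count_nseq /= eqxx mul1n big1 ?addn0 // => x /negbTE ne.
  by rewrite count_nseq /= ne.
have szw : size ws == N.
  rewrite size_sort size_flatten /shape -map_comp sumnE big_map big_enum /= -fsum.
  by apply/eqP; apply: eq_bigr => w _; rewrite size_nseq.
pose u i := tnth (Tuple szw) i.
have cu w : #|[set i | u i == w]| = f w.
  by rewrite -count_map_card map_tnth_enum /= cs0.
have leT : transitive (relpre key leq) by move=> x y z /=; apply: leq_trans.
have srt : sorted (relpre key leq) ws by apply: sort_sorted => x y /=; apply: leq_total.
have kmono (i j : 'I_N) : i < j -> key (u i) <= key (u j).
  move=> lij; rewrite /u !(tnth_nth (u i)) /=.
  by apply: (sorted_ltn_nth leT (u i) srt) => //; rewrite inE (eqP szw).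
have klt (i j : 'I_N) : key (u i) < key (u j) -> i < j.
  move=> h; case: (ltngtP i j) => // [/kmono|/val_inj e]; first by rewrite leqNgt h.
  by rewrite e ltnn in h.
have ex i : exists j, (u j == shift (u i)) && (rank u j == rank u i).
  have := rank_bound u i; rewrite cu -finv -cu => /rank_ex[j e1 e2].
  by exists j; rewrite e1 e2 !eqxx.
pose s' i := xchoose (ex i).
have us' i : u (s' i) = shift (u i) by have /andP[/eqP] := xchooseP (ex i).
have rs' i : rank u (s' i) = rank u i by have /andP[_ /eqP] := xchooseP (ex i).
have s'inj : injective s'.
  move=> i j e; apply: (@rank_inj _ _ u); last by rewrite -(rs' i) -(rs' j) e.
  by apply: (@perm_inj _ shift); rewrite -!us' e.
pose s : 'S_N := perm s'inj.
have us i : u (s i) = shift (u i) by rewrite permE.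
have rs i : rank u (s i) = rank u i by rewrite permE.
have admu i : adm (u i).
  by apply: fadm; rewrite -cu; apply/card_gt0P; exists i; rewrite inE.
(* Inside one class the order is that of the ranks, which [s] preserves; so [i < s i] excludes equal
   keys, and [adm_bar] applies. *)
have exc (i : 'I_N) : (i < s i) = (hd (u i)).2.
  rewrite -adm_bar // -us; apply/idP/idP; last exact: klt.
  move=> h; rewrite ltn_neqAle kmono // andbT; apply/eqP => /key_inj e.
  have e' := e (@code_inj m) (@code_lt m).
  by rewrite (rank_ltE e') rs ltnn in h.
have smono (i j : 'I_N) : u i = u j -> i < j -> s i < s j.
  by move=> e; rewrite (rank_ltE e) (@rank_ltE _ _ u (s i)) ?us ?e // !rs.
pose c : {ffun 'I_N -> 'I_m} := [ffun i => (hd (u i)).1].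
have lc i : lett s c i = hd (u i) by rewrite /lett exc ffunE; case: (hd _).
have po i : #|porbit s i| = #|porbit shift (u i)| by apply: card_porbit_u.
have dv i : #|porbit s i| %| l.+1 by rewrite po card_porbit_shift.
exists s, c; split=> //; last first.
  move=> w; rewrite -cu; apply: eq_card => i; rewrite !inE; congr (_ == _).
  by apply: word_ext => k; rewrite hd_cycle_word // lc (u_iter us).
apply/compatP => i j lij; rewrite kappa_lt !lc.
have kij := kmono _ _ lij.
have := key_hd_le (@code_lt m) kij; rewrite leq_eqVlt => /orP[/eqP e|->//].
rewrite e ltnn eqxx /=; have {}e := code_inj e.
move: kij; rewrite leq_eqVlt => /orP[/eqP/key_inj h|h].
  by apply: smono => //; apply: h; [apply: code_inj | apply: code_lt].
by apply: klt; rewrite !us key_shift_lt //; apply: code_lt.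
Qed.

End Surj.

(** * The correspondence as an identity of sums *)

Section Sum.
Variables (m l B : nat) (R : comNzRingType) (wt : letter m -> R).
Notation letter := (letter m).
Notation word := (cyclic_word letter l).
Notation shift := (rotation letter l).
Notation order w := #|porbit shift w|.
Implicit Types (f g : {ffun word -> 'I_B.+1}).

Lemma order_shift w : order (shift w) = order w.
Proof. by have := porbit_perm shift 1 w; rewrite expg1 => ->. Qed.

Lemma order_le w : order w < l.+2.
Proof. by rewrite ltnS dvdn_leq ?card_porbit_shift. Qed.

(* The bound B only serves to make the multiplicity functions a finite type. *)
Definition necklace_mults la f :=
  [&& [forall w, f (shift w) == f w], [forall w, (0 < f w) ==> adm w] &
      [forall r : 'I_l.+2, \sum_(w | order w == r) f w == r * mult r la]].

Definition mults_wt f : R := (\prod_w wt (hd w) ^+ f w)%R.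

Definition period_mults r M f :=
  [&& [forall w, f (shift w) == f w],
      [forall w, (0 < f w) ==> adm w && (order w == r)] & \sum_w f w == r * M].

Definition period_sum r M : R := (\sum_(f | period_mults r M f) mults_wt f)%R.

(** The pairs are grouped by the multiplicities of their cycle words; each fiber is a single pair by
    [cycle_word_surj] and [cycle_word_inj]. *)
Lemma sum_compat_mults N la : is_partn N la -> N <= B -> (forall r, r \in la -> r %| l.+1) ->
  (\sum_(s : 'S_N | cycle_type s == la)
     \sum_(c : {ffun 'I_N -> 'I_m} | compat s c) \prod_i wt (lett s c i)
   = \sum_(f | necklace_mults la f) mults_wt f)%R.
Proof.
move=> pla NB dla.
have dv (s : 'S_N) i : cycle_type s == la -> #|porbit s i| %| l.+1.
  move/(cycle_typeP _ pla) => h; apply: dla.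
  have : 0 < #|[set j | #|porbit s j| == #|porbit s i|]|.
    by apply/card_gt0P; exists i; rewrite inE.
  by rewrite h muln_gt0 => /andP[_]; rewrite -has_count has_pred1.
pose Phi (p : 'S_N * {ffun 'I_N -> 'I_m}) : {ffun word -> 'I_B.+1} :=
  [ffun w => inord #|[set i | cycle_word l p.1 p.2 i == w]|].
have PhiE p w : Phi p w = #|[set i | cycle_word l p.1 p.2 i == w]| :> nat.
  rewrite ffunE inordK // ltnS (leq_trans _ NB) //.
  by rewrite -[X in _ <= X]card_ord; apply: max_card.
rewrite pair_big_dep /= (partition_big Phi (necklace_mults la)) /=; last first.
  move=> [s c] /= /andP[ct cp]; have dvs i := dv s i ct.
  apply/and3P; split.
  - apply/forallP => w; rewrite -val_eqE /= !PhiE /=.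
    rewrite -[in X in _ == X](card_imset _ (@perm_inj _ s)); apply/eqP/eq_card => i.
    rewrite inE; apply/eqP/imsetP => [e|[j]].
      exists (s^-1%g i); last by rewrite permKV.
      by rewrite inE -(inj_eq (@perm_inj _ shift)) -cycle_word_s // permKV e.
    by rewrite inE => /eqP e ->; rewrite cycle_word_s // e.
  - apply/forallP => w; apply/implyP; rewrite PhiE => /card_gt0P[i].
    by rewrite inE /= => /eqP <-; apply: adm_cycle_word.
  apply/forallP => r; rewrite -(cycle_typeP _ pla ct).
  rewrite (sum_card_porbit (cycle_word_s c dvs) (cycle_word_mono cp dvs) (eq_op^~ (val r))).
  by apply/eqP; apply: eq_bigr => w _; rewrite PhiE.
apply: eq_bigr => f /and3P[/forallP f1 /forallP f2 /forallP f3].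
have lak r : r \in la -> r < l.+2 by move/dla => h; rewrite ltnS dvdn_leq.
have [||| s [c [cp dvs cnt]]] := @cycle_word_surj m l N (fun w => f w).
- by move=> w; rewrite (eqP (f1 w)).
- by move=> w h; apply: (implyP (f2 w)).
- rewrite (partition_big (fun w => Ordinal (order_le w)) predT) //=.
  case/and3P: pla => _ _ /eqP <-; rewrite -(sumn_mult lak); apply: eq_bigr => r _.
  by rewrite -(eqP (f3 r)).
have ct : cycle_type s == la.
  apply/(cycle_typeP _ pla) => r.
  rewrite (sum_card_porbit (cycle_word_s c dvs) (cycle_word_mono cp dvs) (eq_op^~ r)).
  have [hr|hr] := ltnP r l.+2.
    by rewrite -(eqP (f3 (Ordinal hr))); apply: eq_bigr.
  rewrite big1 => [|w /eqP e]; last by have := order_le w; rewrite e; lia.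
  rewrite /mult (_ : count_mem r la = 0) ?muln0 //; apply/count_memPn.
  by apply/negP => /lak; lia.
rewrite (big_pred1 (s, c)) => [|[s' c'] /=].
  rewrite /mults_wt (partition_big (cycle_word l s c) predT) //=; apply: eq_bigr => w _.
  rewrite -cnt -prodr_const; apply: congr_big => // [i|i /eqP <-]; first by rewrite inE.
  by rewrite -[cycle_word l s c i]/(iter 0 shift (cycle_word l s c i)) hd_cycle_word.
apply/idP/eqP => [/andP[/andP[ct' cp'] /eqP e]|[-> ->]].
  have [||e1 e2] := @cycle_word_inj m l N s' c' s c cp' _ cp dvs; last by rewrite e1 e2.
    by move=> i; apply: dv.
  by move=> w; rewrite cnt -e PhiE.
by rewrite ct cp; apply/eqP/ffunP => w; apply: val_inj; rewrite /= PhiE cnt.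
Qed.

(** A multiplicity function is the same as the family of its restrictions to the words of each
    period, and its weight is the product of theirs. *)
Lemma necklace_mults_prod la :
  (\sum_(f | necklace_mults la f) mults_wt f = \prod_(r < l.+2) period_sum r (mult r la))%R.
Proof.
rewrite /period_sum bigA_distr_big_dep /=.
pose o w := Ordinal (order_le w).
pose h (G : {ffun 'I_l.+2 -> {ffun word -> 'I_B.+1}}) : {ffun word -> 'I_B.+1} :=
  [ffun w => G (o w) w].
pose h' f : {ffun 'I_l.+2 -> {ffun word -> 'I_B.+1}} :=
  [ffun r => [ffun w => if o w == r then f w else ord0]].
rewrite (reindex_onto h h') => [|f _]; last first.
  by apply/ffunP => w; rewrite !ffunE eqxx.
have sup r M f w : period_mults r M f -> order w != r -> f w = ord0.
  case/and3P=> _ /forallP/(_ w) hf _ ne; apply: val_inj => /=.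
  by move: hf; case: (val (f w)) => //= k; rewrite (negbTE ne) andbF.
have osh w : o (shift w) = o w by apply: val_inj; apply: order_shift.
apply: congr_big => // G.
  apply/andP/familyP => [[/and3P[/forallP f1 /forallP f2 /forallP f3] /eqP <-] r|hG].
    rewrite [h' _ _]ffunE; apply/and3P; split.
    - apply/forallP => w; rewrite !ffunE osh; case: ifP => // _.
      by have := f1 w; rewrite !ffunE osh.
    - apply/forallP => w; rewrite ffunE -val_eqE /=; case: ifP => // e.
      by rewrite andbT; apply: f2.
    rewrite -(eqP (f3 r)) [X in _ == X]big_mkcond /=; apply/eqP; apply: eq_bigr => w _.
    by rewrite ffunE -val_eqE /=; case: ifP.
  have hGr (r : 'I_l.+2) : period_mults r (mult r la) (G r) by apply: hG.
  split; last first.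
    apply/eqP/ffunP => r; apply/ffunP => w; rewrite !ffunE.
    case: eqP => [->//|/eqP ne]; rewrite (sup _ _ _ _ (hGr r)) //.
  apply/and3P; split.
  - apply/forallP => w; rewrite !ffunE osh.
    by case/and3P: (hGr (o w)) => /forallP/(_ w).
  - apply/forallP => w; apply/implyP; rewrite ffunE => hw.
    by case/and3P: (hGr (o w)) => _ /forallP/(_ w); rewrite hw /= => /andP[].
  apply/forallP => r; case/and3P: (hGr r) => _ _ /eqP <-.
  rewrite big_mkcond /=; apply/eqP; apply: eq_bigr => w _; case: ifP => [e|/negbT ne].
    by rewrite ffunE (_ : o w = r) //; apply: val_inj; apply/eqP.
  by rewrite (sup _ _ _ _ (hGr r)).
case/andP=> _ /eqP e; rewrite /mults_wt exchange_big /=; apply: eq_bigr => w _.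
rewrite (bigD1 (o w)) //= big1 ?mulr1 => [|r ne]; first by rewrite ffunE.
by rewrite -e !ffunE eq_sym (negbTE ne) expr0.
Qed.

Lemma period_sum0 r : period_sum r 0 = 1%R.
Proof.
rewrite /period_sum (big_pred1 [ffun=> ord0]) => [|f /=].
  by rewrite /mults_wt big1 // => w _; rewrite ffunE.
rewrite /period_mults muln0 sum_nat_eq0; apply/and3P/eqP => [[_ _ /forallP h]|->].
  by apply/ffunP => w; rewrite ffunE; apply: val_inj; apply/eqP/h.
split; apply/forallP => w; rewrite !ffunE //=.
Qed.

End Sum.

(** * Newton recursions for sums over multisets of words *)

Lemma prod_porbit (R : comNzRingType) (T : finType) (s : {perm T}) x (F : T -> R) :
  (\prod_(y in porbit s x) F y = \prod_(j < #|porbit s x|) F (iter j s x))%R.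
Proof.
rewrite (eq_bigl _ _ (porbit_traject s x)) /= -big_uniq ?uniq_traject_porbit //.
rewrite (big_nth x) size_traject big_mkord.
by apply: eq_bigr => j _; rewrite nth_traject.
Qed.

Lemma prod_iter_porbit (R : comNzRingType) (T : finType) (s : {perm T}) x (F : T -> R) e :
  (\prod_(j < e * #|porbit s x|) F (iter j s x) = (\prod_(y in porbit s x) F y) ^+ e)%R.
Proof.
rewrite prod_porbit; elim: e => [|e IH]; first by rewrite mul0n big_ord0 expr0.
rewrite mulSn big_split_ord /= exprS -IH; congr (_ * _)%R.
by apply: eq_bigr => j _; rewrite addnC iterD iter_porbit.
Qed.

Section Newton.
Variables (m l B : nat) (R : comNzRingType) (wt : letter m -> R).
Notation letter := (letter m).
Notation word := (cyclic_word letter l).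
Notation shift := (rotation letter l).
Notation order w := #|porbit shift w|.
Implicit Types (f g : {ffun word -> 'I_B.+1}).

Definition orbwt w : R := (\prod_(x in porbit shift w) wt (hd x))%R.

(** The [k]-th power sum of the weights of primitive necklaces of length [r], each counted [r]
    times, once per rotation. *)
Definition primitive_sum r k : R := (\sum_(w | adm w && (order w == r)) orbwt w ^+ k)%R.

Lemma inv_porbit f w x : (forall y, f (shift y) == f y) -> x \in porbit shift w -> f x = f w.
Proof.
move=> h /porbitP[i ->]; rewrite permX; elim: i => //= i <-; exact/eqP/h.
Qed.

Lemma mem_porbit_shift w x : (shift x \in porbit shift w) = (x \in porbit shift w).
Proof.
by rewrite -!eq_porbit_mem; have := porbit_perm shift 1 x; rewrite expg1 => ->.
Qed.

Lemma order_gt0 w : 0 < order w.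
Proof. by rewrite lt0n card_porbit_neq0. Qed.

(* Removing k copies of each rotation of w from f. *)
Lemma period_sum_sub r M k w : r * M <= B -> 0 < k <= M -> adm w -> order w = r ->
  (\sum_(f : {ffun word -> 'I_B.+1} | period_mults r M f && (k <= f w)%N) mults_wt wt f =
   orbwt w ^+ k * period_sum l B wt r (M - k))%R.
Proof.
move=> rB /andP[k0 kM] aw ow.
have r0 : 0 < r by rewrite -ow order_gt0.
pose d x := if x \in porbit shift w then k else 0.
have dsh x : d (shift x) = d x by rewrite /d mem_porbit_shift.
have sd : \sum_x d x = r * k by rewrite -big_mkcond sum_nat_const ow.
pose h g : {ffun word -> 'I_B.+1} := [ffun x => inord (g x + d x)].
pose h' f : {ffun word -> 'I_B.+1} := [ffun x => inord (f x - d x)].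
have h'E f x : h' f x = f x - d x :> nat.
  by rewrite ffunE inordK //; apply: leq_ltn_trans (leq_subr _ _) (ltn_ord _).
have bnd r' M' f x : period_mults r' M' f -> f x <= r' * M'.
  by case/and3P=> _ _ /eqP <-; rewrite (bigD1 x) //= leq_addr.
have porb_adm x : x \in porbit shift w -> adm x && (order x == r).
  move=> hx; have := hx; rewrite -eq_porbit_mem => /eqP ->; rewrite ow eqxx andbT.
  case/porbitP: hx => i ->; rewrite permX; elim: i => //= i; exact: adm_shift.
have P_d f x : period_mults r M f && (k <= f w) -> d x <= f x.
  case/andP=> /and3P[/forallP f1 _ _] kf; rewrite /d; case: ifP => // hx.
  by rewrite (inv_porbit f1 hx).
rewrite (reindex_onto h h') => [|f Pf]; last first.
  apply/ffunP => x; apply: val_inj; rewrite /= [h _ _]ffunE h'E subnK ?P_d //.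
  by rewrite inord_val.
rewrite /period_sum big_distrr /=.
have EQ g : period_mults r M (h g) && (k <= h g w) && (h' (h g) == g) = period_mults r (M - k) g.
  apply/idP/idP.
    case/andP => Pf /eqP e; set f := h g in Pf e.
    have gE x : (g x + d x)%N = f x by rewrite -e h'E subnK // P_d.
    have [/and3P[/forallP f1 /forallP f2 /eqP f3] kf] := andP Pf.
    apply/and3P; split.
    - apply/forallP => x; rewrite -val_eqE /= -(eqn_add2r (d x)) -{1}dsh !gE.
      by rewrite (eqP (f1 x)).
    - apply/forallP => x; apply/implyP => gx; apply: (implyP (f2 x)).
      by rewrite -gE; lia.
    rewrite -(eqn_add2r (\sum_x d x)) -big_split /= (eq_bigr (fun x => f x : nat)) // f3 sd.
    by rewrite -mulnDr subnK.
  move=> Pg; have rk : r * (M - k) + k <= r * M.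
    by rewrite mulnBr; have := leq_mul (leqnn r) kM; have := leq_pmull k r0; lia.
  have hE x : h g x = (g x + d x)%N :> nat.
    rewrite ffunE inordK // ltnS; apply: leq_trans (leq_trans _ rk) rB.
    by apply: leq_add; [exact: bnd Pg | rewrite /d; case: ifP].
  have [/forallP g1 /forallP g2 /eqP g3] := and3P Pg.
  rewrite hE /d porbit_id leq_addl andbT; apply/andP; split; last first.
    by apply/eqP/ffunP => x; apply: val_inj; rewrite /= h'E hE addnK.
  apply/and3P; split.
  - by apply/forallP => x; rewrite -val_eqE /= !hE dsh (eqP (g1 x)).
  - apply/forallP => x; apply/implyP; rewrite hE /d; case: ifP => [/porb_adm//|_].
    by rewrite addn0; apply: (implyP (g2 x)).
  rewrite (eq_bigr (fun x => g x + d x)%N) => [|x _]; last exact: hE.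
  by rewrite big_split /= g3 sd -mulnDr subnK.
apply: congr_big => // g; rewrite EQ // => Pg.
have hE x : h g x = (g x + d x)%N :> nat.
  have /andP[Pf /eqP e] : period_mults r M (h g) && (k <= h g w) && (h' (h g) == g) by rewrite EQ.
  by rewrite -{2}e h'E subnK // P_d.
rewrite /mults_wt /orbwt -prodrXl [X in (_ = X * _)%R]big_mkcond -big_split /=.
apply: eq_bigr => x _; rewrite hE exprD mulrC /d.
by case: ifP; rewrite ?expr0.
Qed.

(** Newton's identity for complete symmetric functions of the necklace weights. The factor [r * M]
    counts the pairs of a word [w] and a number [k] from 1 to [f w]; removing [k] copies of the
    necklace of [w] yields the right side. *)
Lemma period_sum_newton r M : r * M <= B ->
  ((r * M)%:R * period_sum l B wt r M =
   \sum_(1 <= k < M.+1) primitive_sum r k * period_sum l B wt r (M - k))%R.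
Proof.
move=> rB.
(* The [r] rotations of [w] share the multiplicity [f w], and the total is [r * M]. *)
have fM f w : period_mults r M f -> f w <= M.
  case/and3P=> /forallP f1 /forallP f2 /eqP f3.
  case: (posnP (f w)) => [->//|fw]; have /andP[_ /eqP ow] := implyP (f2 w) fw.
  have r0 : 0 < r by rewrite -ow order_gt0.
  rewrite -(leq_pmul2l r0) -f3 (bigID (mem (porbit shift w))) /=.
  rewrite (eq_bigr (fun=> val (f w))) => [|x hx]; last by rewrite (inv_porbit f1 hx).
  by rewrite sum_nat_const ow leq_addr.
transitivity (\sum_w \sum_(1 <= k < M.+1)
  \sum_(f : {ffun word -> 'I_B.+1} | period_mults r M f && (k <= f w)%N) mults_wt wt f)%R.
  rewrite /period_sum big_distrr /=.
  under [RHS]eq_bigr => w _ do (under eq_bigr => k _ do rewrite big_mkcondr;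
    rewrite exchange_big /=).
  rewrite exchange_big /=; apply: eq_bigr => f Pf.
  have /and3P[_ _ /eqP <-] := Pf.
  rewrite natr_sum big_distrl /=; apply: eq_bigr => w _.
  rewrite -big_mkcond /= big_const_seq iter_addr_0 mulr_natl; congr (_ *+ _)%R.
  rewrite -size_filter /index_iota subSS subn0.
  have := fM f w Pf; move: (val (f w)) => n le.
  rewrite -(subnKC le) iotaD filter_cat size_cat.
  rewrite (eq_in_filter (a2 := predT)) => [|x]; last by rewrite mem_iota /=; lia.
  rewrite filter_predT size_iota (eq_in_filter (a2 := pred0)) => [|x].
    by rewrite filter_pred0 addn0.
  by rewrite mem_iota /=; lia.
rewrite (bigID (fun w => adm w && (order w == r))) /= [X in (_ + X)%R]big1 ?addr0; last first.
  move=> w nw; rewrite big_nat_cond big1 // => k /andP[/andP[k1 _] _].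
  apply: big1 => f /andP[/and3P[_ /forallP/(_ w) f2 _] kf]; case/negP: nw.
  by apply: (implyP f2); apply: leq_trans kf.
rewrite exchange_big /=; rewrite !big_nat; apply: eq_bigr => k hk.
rewrite /primitive_sum big_distrl /=; apply: eq_bigr => w /andP[aw /eqP ow].
by rewrite period_sum_sub //; lia.
Qed.

Definition closed_sum r k : R :=
  (\sum_(w | adm w && (iter r shift w == w))
      (\prod_(j < r) wt (hd (iter j shift w))) ^+ k)%R.

(** A word fixed by [r] rotations has a primitive period [d] dividing [r], and [r] letters of it run
    through its necklace [r %/ d] times. *)
Lemma closed_sum_primitive r k : 0 < r ->
  (closed_sum r k = \sum_(d < r.+1 | (d %| r)%N) primitive_sum d (k * (r %/ d))%N)%R.
Proof.
move=> r0; rewrite /closed_sum.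
rewrite (partition_big (fun w => inord (order w) : 'I_r.+1) (fun d => d %| r)) /=; last first.
  move=> w /andP[_]; rewrite iter_eq_dvd => h; rewrite inordK // ltnS; exact: dvdn_leq.
apply: eq_bigr => d dr; apply: congr_big => // w.
  rewrite -andbA iter_eq_dvd; congr (_ && _); apply/andP/eqP => [[h /eqP <-]|e].
    by rewrite inordK // ltnS dvdn_leq.
  by rewrite e dr inord_val.
rewrite -andbA => /and3P[_]; rewrite iter_eq_dvd => h /eqP e.
have -> : (d : nat) = order w by rewrite -e inordK // ltnS dvdn_leq.
have := prod_iter_porbit shift w (fun x => wt (hd x)) (r %/ order w).
by rewrite divnK // => ->; rewrite -exprM mulnC.
Qed.

(** Such words are determined by their first [r'.+1] letters, which removes the auxiliary length
    [l.+1]. *)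
Lemma closed_sum_word r' k : r'.+1 %| l.+1 ->
  (closed_sum r'.+1 k = \sum_(v : cyclic_word letter r' | adm v) (\prod_j wt (v j)) ^+ k)%R.
Proof.
move=> dv; rewrite /closed_sum.
pose sh := rotation letter r'.
pose h (v : cyclic_word letter r') : word := word_of l (fun k => hd (iter k sh v)).
pose h' (w : word) : cyclic_word letter r' := word_of r' (fun k => hd (iter k shift w)).
have hE v i : hd (iter i shift (h v)) = hd (iter i sh v).
  rewrite hd_word_of // => j; rewrite iterD; congr (hd (iter j sh _)).
  by apply/eqP; rewrite iter_eq_dvd (dvdn_trans (card_porbit_shift v)).
rewrite (reindex_onto h h') => [|w /andP[_ /eqP it]]; last first.
  apply: word_ext => i; rewrite hE hd_word_of // => j.
  by rewrite iterD it.
apply: congr_big => // v.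
  have -> : h' (h v) = v.
    apply: word_ext => i; rewrite hd_word_of ?hE // => j.
    by rewrite !hE iterD iter_shift_size.
  have -> : iter r'.+1 shift (h v) = h v.
    by apply: word_ext => i; rewrite -iterD !hE iterD iter_shift_size.
  rewrite !eqxx !andbT; apply/admP/admP => -[h1 [i hi]]; split.
  - by move=> j; have := h1 j; rewrite !hE.
  - by exists i; rewrite -hE.
  - by move=> j; rewrite !hE.
  by exists i; rewrite hE.
move=> _; congr (_ ^+ _)%R; apply: eq_bigr => j _; congr wt.
by rewrite hE hd_iter valZpK.
Qed.

End Newton.

Local Open Scope ring_scope.

(** * Closed words and traces *)

Section ClosedWalks.
Variables (R : comNzRingType) (m : nat).

Section Walk.
Variable M : 'M[R]_m.

Fixpoint walk_prod (x : 'I_m) (s : seq 'I_m) z :=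
  if s is y :: s' then M x y * walk_prod y s' z else M x z.

Lemma walk_prodE x s z :
  walk_prod x s z = \prod_(j < (size s).+1) M (nth z (x :: s) j) (nth z s j).
Proof.
elim: s x => [|y s IH] x /=; first by rewrite big_ord_recl big_ord0 mulr1.
by rewrite big_ord_recl /= IH.
Qed.

Lemma sum_tuple_recl k (F : k.+1.-tuple 'I_m -> R) :
  \sum_t F t = \sum_x \sum_(t : k.-tuple 'I_m) F [tuple of x :: t].
Proof.
rewrite pair_big /=.
rewrite (reindex (fun p : 'I_m * k.-tuple 'I_m => [tuple of p.1 :: p.2])) //=.
exists (fun t => (thead t, [tuple of behead t])) => [[x t] _|t _] /=.
  by congr pair; apply: val_inj.
by rewrite [RHS]tuple_eta.
Qed.

Lemma sum_walk_prod k x z :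
  \sum_(t : k.-tuple 'I_m) walk_prod x t z = (M ^+ k.+1) x z.
Proof.
elim: k x => [|k IH] x.
  rewrite (big_pred1 [tuple]) => [|t]; first by rewrite expr1.
  by rewrite /= [t]tuple0; apply/esym/eqP.
rewrite sum_tuple_recl exprS mxE; apply: eq_bigr => y _.
by rewrite -IH big_distrr.
Qed.

Lemma tr_closed_walk k :
  \tr (M ^+ k.+1) = \sum_(a : {ffun 'I_k.+1 -> 'I_m}) \prod_j M (a j) (a (ordS j)).
Proof.
rewrite (reindex (fun t : k.+1.-tuple 'I_m => [ffun i => tnth t i])) /=; last first.
  exists (fun a => [tuple a i | i < k.+1]) => [t _|a _].
    by apply: eq_from_tnth => i; rewrite tnth_mktuple ffunE.
  by apply/ffunP => i; rewrite ffunE tnth_mktuple.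
rewrite sum_tuple_recl; apply: eq_bigr => x _; rewrite -sum_walk_prod.
apply: eq_bigr => t _; rewrite walk_prodE size_tuple; apply: eq_bigr => j _.
rewrite !ffunE !(tnth_nth x) /=; congr (M _ _).
have := ltn_ord j; rewrite ltnS leq_eqVlt => /orP[/eqP ->|lj].
  by rewrite modnn /= nth_default // size_tuple.
by rewrite modn_small.
Qed.
End Walk.

Variable wt : letter m -> R.

(** The entry at [a], [b] adds the weights of the bars allowed on a letter of color [a] followed by
    one of color [b]. *)
Definition walk_mx : 'M[R]_m := \matrix_(a, b)
  ((if (b <= a)%N then wt (a, true) else 0) + (if (a <= b)%N then wt (a, false) else 0)).

Lemma sum_step_word k :
  \sum_(v : cyclic_word (letter m) k | [forall i, step (v i) (v (ordS i))]) \prod_j wt (v j)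
  = \tr (walk_mx ^+ k.+1).
Proof.
rewrite tr_closed_walk.
pose s (a b : 'I_m) (x : bool) := if step (a, x) (b, x) then wt (a, x) else 0.
transitivity (\sum_(a : {ffun 'I_k.+1 -> 'I_m}) \sum_(x : {ffun 'I_k.+1 -> bool})
    \prod_j s (a j) (a (ordS j)) (x j)); last first.
  apply: eq_bigr => a _.
  rewrite -(bigA_distr_bigA (fun j x => s (a j) (a (ordS j)) x)) /=.
  by apply: eq_bigr => j _; rewrite big_bool mxE.
rewrite pair_big /= big_mkcond /=.
rewrite (reindex (fun p : {ffun 'I_k.+1 -> 'I_m} * {ffun 'I_k.+1 -> bool} =>
   [ffun j => (p.1 j, p.2 j)] : cyclic_word (letter m) k)) /=; last first.
  exists (fun v => ([ffun j => (v j).1], [ffun j => (v j).2])) => [[a x] _|v _] /=.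
    by congr pair; apply/ffunP => j; rewrite !ffunE.
  by apply/ffunP => j; rewrite !ffunE /=; case: (v j).
apply: eq_bigr => -[a x] _ /=; case: ifP => [/forallP h|/negbT].
  apply: eq_bigr => j _; rewrite /s ffunE /=.
  by have := h j; rewrite !ffunE /step /= => ->.
rewrite negb_forall => /existsP[j /negbTE hj]; rewrite (bigD1 j) //= /s.
by move: hj; rewrite !ffunE /step /= => ->; rewrite mul0r.
Qed.

(** The closed words to be discarded are all barred: their colors decrease weakly around a circle,
    so they are constant. *)
Lemma sum_adm_word k :
  \sum_(v : cyclic_word (letter m) k | adm v) \prod_j wt (v j)
  = \tr (walk_mx ^+ k.+1) - \sum_a wt (a, true) ^+ k.+1.
Proof.
rewrite -sum_step_word.
rewrite [X in X - _](bigID (fun v : cyclic_word (letter m) k => [exists i, ~~ (v i).2])) /=.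
rewrite -[LHS]addr0 -addrA; congr (_ + _).
apply/esym/eqP; rewrite subr_eq0; apply/eqP.
rewrite (reindex_onto (fun a : 'I_m => [ffun=> (a, true)] : cyclic_word (letter m) k)
   (fun v => (hd v).1)) /=.
  apply: congr_big => // a; last by rewrite (eq_bigr (fun=> wt (a, true))) ?prodr_const ?card_ord //
     => j _; rewrite ffunE.
  rewrite /hd ffunE eqxx andbT negb_exists; apply/andP; split.
    by apply/forallP => j; rewrite !ffunE /step /=.
  by apply/forallP => j; rewrite ffunE.
move=> v /andP[/forallP st]; rewrite negb_exists => /forallP hb.
have vb j : (v j).2 by have := hb j; rewrite negbK.
have mono j : ((v (inZp j.+1)).1 <= (v (inZp j)).1)%N.
  by have := st (inZp j); rewrite ordS_inZp /step vb.
have dec j : ((v (inZp j)).1 <= (hd v).1)%N.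
  elim: j => [|j IH]; first by rewrite -hd_iter.
  exact: leq_trans (mono j) IH.
(* Walking from [i] on to position [k.+1], which is position 0 again, reverses the inequality
   [dec]. *)
have inc n j : ((v (inZp (j + n))).1 <= (v (inZp j)).1)%N.
  elim: n => [|n IH]; first by rewrite addn0.
  by rewrite addnS; apply: leq_trans (mono _) IH.
apply/ffunP => i; rewrite ffunE; have := vb i; case E: (v i) => [a b] /= ->.
congr pair; apply/val_inj/eqP; rewrite eqn_leq /=.
have := dec i; rewrite valZpK E /= => ->; rewrite andbT.
have := inc (k.+1 - i)%N i; rewrite valZpK E /= subnKC ?(ltnW (ltn_ord i)) //.
have -> : (inZp k.+1 : 'I_k.+1) = ord0 by apply: val_inj => /=; rewrite modnn.
by [].
Qed.

End ClosedWalks.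

(** * Determinants and Newton's identities for traces *)

Section TraceNewton.
Variable R : comNzRingType.

Lemma deriv_prod (I : eqType) (r : seq I) (F : I -> {poly R}) : uniq r ->
  (\prod_(i <- r) F i)^`() =
  \sum_(i <- r) (F i)^`() * \prod_(j <- r | j != i) F j.
Proof.
elim: r => [|a r IH] /=; first by rewrite !big_nil derivC.
case/andP=> ar ur; rewrite !big_cons derivM IH // eqxx /=; congr (_ * _ + _).
  rewrite big_seq [RHS]big_seq_cond; apply: eq_big => i //; rewrite andbC.
  by case: eqP => // -> /=; rewrite (negbTE ar).
rewrite big_distrr big_seq [RHS]big_seq /=; apply: eq_bigr => i ir.
have ne : a != i by apply: contraNneq ar => ->.
by rewrite big_cons ne mulrCA.
Qed.

(** Jacobi's formula. The matrix [Q i] has its row [i] differentiated, and expansion along that row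
    produces the adjugate. *)
Lemma deriv_det n (P : 'M[{poly R}]_n) :
  (\det P)^`() = \tr (\adj P *m map_mx (@deriv R) P).
Proof.
pose Q i := \matrix_(a, b) (if a == i then (P a b)^`() else P a b).
have -> : (\det P)^`() = \sum_i \det (Q i).
  rewrite /determinant raddf_sum /= exchange_big /=; apply: eq_bigr => s _.
  have dsign (b : bool) (p : {poly R}) : ((-1) ^+ b * p)^`() = (-1) ^+ b * p^`().
    by rewrite !mulr_sign; case: b; rewrite ?derivN.
  rewrite -big_distrr dsign deriv_prod ?index_enum_uniq //=; congr (_ * _).
  apply: eq_bigr => i _; rewrite [RHS](bigD1 i) //= mxE eqxx.
  by congr (_ * _); apply: eq_bigr => j /negbTE ne; rewrite mxE ne.
rewrite mxtrace_mulC; apply: eq_bigr => i _; rewrite (expand_det_row _ i) mxE.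
apply: eq_bigr => j _; rewrite !mxE eqxx; congr (_ * _).
rewrite /cofactor; congr (_ * \det _); apply/matrixP => a b.
by rewrite !mxE eq_sym (negbTE (neq_lift _ _)).
Qed.

Variables (n : nat) (A : 'M[R]_n).
Let Ah := map_mx (@polyC R) A.
Definition rev_char := \det (1%:M - 'X *: Ah).

Lemma rev_char_resolvent N :
  (1%:M - 'X *: Ah) *m (\sum_(i < N) 'X^i *: Ah ^+ i) = 1%:M - 'X^N *: Ah ^+ N.
Proof.
elim: N => [|N IH]; first by rewrite big_ord0 mulmx0 !expr0 scale1r subrr.
rewrite big_ord_recr /= mulmxDr IH mulmxBl mul1mx -scalemxAl -scalemxAr scalerA -exprS.
by rewrite (exprS Ah) addrA subrK.
Qed.

(** The logarithmic derivative of the determinant, with the inverse matrix replaced by a truncated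
    geometric series; [G] collects the error. *)
Lemma rev_char_deriv N : exists G,
  - rev_char^`() = rev_char * \poly_(i < N) \tr (A ^+ i.+1) + 'X^N * G.
Proof.
set P := 1%:M - 'X *: Ah.
have dP : map_mx (@deriv R) P = - Ah.
  apply/matrixP => i j; rewrite !mxE derivB derivM derivX derivC mulr0 addr0 mul1r.
  by rewrite derivMn -polyC1 derivC mul0rn sub0r.
rewrite /rev_char deriv_det -/P dP mulmxN raddfN opprK.
have := congr1 (fun Z => \adj P *m Z *m Ah) (rev_char_resolvent N).
rewrite -/P mulmxA mul_adj_mx mul_scalar_mx mulmxBr mulmx1 mulmxBl.
move/eqP; rewrite eq_sym subr_eq => /eqP ->.
exists (\tr (\adj P *m Ah ^+ N *m Ah)).
rewrite raddfD /= -scalemxAr -!scalemxAl !linearZ /=; congr (_ * _ + _).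
rewrite mulmx_suml raddf_sum poly_def; apply: eq_bigr => i _ /=.
rewrite -scalemxAl linearZ /= -[_ *m Ah]/(Ah ^+ i * Ah) -exprSr -rmorphXn.
by rewrite /= trace_map_mx mulrC mul_polyC.
Qed.

(** Coefficient of degree [k] in [rev_char_deriv], whose error term starts in degree [k.+1]. *)
Lemma trace_newton k : (k.+1)%:R * rev_char`_k.+1 =
  - \sum_(i < k.+1) rev_char`_(k - i) * \tr (A ^+ i.+1).
Proof.
have [G e] := rev_char_deriv k.+1.
have /(congr1 (fun p : {poly R} => p`_k)) := e.
rewrite coefN coef_deriv coefD coefXnM ltnSn addr0 coefMr => h.
rewrite mulr_natl -[LHS]opprK h; congr (- _); apply: eq_bigr => i _.
by rewrite coef_poly ltn_ord.
Qed.

Lemma rev_char0 : rev_char`_0 = 1.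
Proof.
rewrite -horner_coef0 /rev_char -horner_evalE -det_map_mx.
have -> : map_mx (horner_eval 0) (1%:M - 'X *: Ah) = 1%:M; last by rewrite det1.
apply/matrixP => i j; rewrite !mxE /horner_eval hornerD hornerN hornerM hornerX.
by rewrite mul0r subr0; case: (i == j); rewrite ?hornerC // -polyC1 hornerC.
Qed.

End TraceNewton.

(** The determinant is that of a bordered matrix in which [c] occurs only in the first column, below
    the corner; expansion along this column is affine in [c]. *)
Lemma det_rank1_affine (R : comNzRingType) n (N : 'M[R]_n) (u : 'cV_n) (v : 'rV_n) :
  exists K, forall c, \det (N + c *: (u *m v)) = \det N + c * K.
Proof.
pose B c := block_mx (1%:M : 'M_1) v (- c *: u) N.
have detB c : \det (B c) = \det (N + c *: (u *m v)).
  have : B c *m block_mx 1%:M (- v) 0 1%:M = block_mx 1%:M 0 (- c *: u) (N + c *: (u *m v)).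
    rewrite mulmx_block !mulmx1 !mul1mx !mulmx0 !addr0 addNr; congr block_mx.
    by rewrite -scalemxAl mulmxN scalerN scaleNr opprK addrC.
  move/(congr1 determinant); rewrite det_mulmx det_ublock det_lblock !det1.
  by rewrite !mulr1 mul1r.
pose o : 'I_(1 + n) := lshift n ord0.
have cof c i : cofactor (B c) i o = cofactor (B 0) i o.
  rewrite /cofactor; congr (_ * \det _); apply/matrixP => a b; rewrite !mxE.
  have -> : lift o b = rshift 1 b by apply: val_inj.
  case: split => x; rewrite !mxE; case E: (split (rshift 1 b)) => [z|z] //;
    by move/(congr1 (fun s => val (unsplit s))): E; rewrite splitK /=; case: z => -[].
have BE c : \det (B c) = cofactor (B 0) o o +
    c * \sum_(i < n) - u i ord0 * cofactor (B 0) (rshift 1 i) o.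
  rewrite (expand_det_col _ o) big_split_ord big_ord1 /= cof.
  rewrite (_ : lshift n ord0 = o) // block_mxEul mxE eqxx mul1r; congr (_ + _).
  rewrite big_distrr; apply: eq_bigr => i _ /=.
  by rewrite cof block_mxEdl mxE mulrA mulrN mulNr.
exists (\sum_(i < n) - u i ord0 * cofactor (B 0) (rshift 1 i) o) => c.
rewrite -detB BE; congr (_ + _).
by have := detB 0; rewrite BE mul0r scale0r !addr0.
Qed.

(** The scaling of the [y i] amounts to replacing the indeterminate by its multiple by [q]. *)
Lemma coef_prod_scale (R : comNzRingType) (I : Type) (r : seq I) (y : I -> R) q k :
  (\prod_(i <- r) (1 - (q * y i) *: 'X))`_k = q ^+ k * (\prod_(i <- r) (1 - y i *: 'X))`_k.
Proof.
elim: r k => [|a r IH] k.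
  by rewrite !big_nil coef1; case: k => [|k]; rewrite ?mul1r ?mulr0.
rewrite !big_cons !mulrBl !mul1r !coefB IH mulrBr; congr (_ - _).
rewrite -!scalerAl !coefZ ![_ * \prod_(_ <- _) _]mulrC !coefMX.
by case: k => [|k] /=; rewrite ?mulr0 // IH exprS; ring.
Qed.

Section WalkDet.
Variables (R : idomainType) (m : nat) (y : 'I_m -> R) (q : R).
Hypothesis q1 : q != 1.

Definition bar_wt (a : letter m) : R := y a.1 * q ^+ a.2.

Definition esym_gf : {poly R} := \prod_i (1 - y i *: 'X).

(** The geometric sum is the quotient of 1 - q^(k+1) by 1 - q, so no denominator in [q] is left. *)
Lemma rev_char_walk k :
  (rev_char (walk_mx bar_wt))`_k = (\sum_(i < k.+1) q ^+ i) * esym_gf`_k.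
Proof.
pose N : 'M[{poly R}]_m := \matrix_(a, b)
  ((a == b)%:R - (y a *: 'X) * ((if (a <= b)%N then (1 - q)%:P else 0) + (q * (a == b)%:R)%:P)).
pose u : 'cV[{poly R}]_m := \col_i (y i)%:P.
pose v : 'rV[{poly R}]_m := const_mx 1.
(* N + c u v is upper triangular for c = 0, lower triangular for c = (1 - q) X,
   and equal to the matrix of the statement for c = - q X. *)
have [K HK] := det_rank1_affine N u v.
have eN0 : \det N = esym_gf.
  rewrite -det_tr det_trig; last first.
    apply/is_trig_mxP => i j lij; rewrite !mxE leqNgt lij -val_eqE /=.
    by rewrite (gtn_eqF lij) /= mulr0 polyC0 addr0 mulr0 subr0.
  apply: eq_bigr => i _; rewrite !mxE eqxx leqnn mulr1 -polyCD subrK mulr1 //.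
have eN1 : \det (N + ((1 - q) *: 'X) *: (u *m v)) = \prod_i (1 - (q * y i) *: 'X).
  rewrite det_trig; last first.
    apply/is_trig_mxP => i j lij; rewrite !mxE big_ord1 !mxE (ltnW lij) -val_eqE /=.
    rewrite (ltn_eqF lij) /= mulr0 polyC0 addr0 mulr1 -!mul_polyC; ring.
  apply: eq_bigr => i _; rewrite !mxE big_ord1 !mxE eqxx leqnn -!mul_polyC /=.
  rewrite !polyCM !polyCB !polyC1; ring.
have eP : rev_char (walk_mx bar_wt) = \det (N + (- q *: 'X) *: (u *m v)).
  congr determinant; apply/matrixP => a b; rewrite !mxE big_ord1 !mxE /bar_wt /=.
  rewrite expr1 expr0 -val_eqE /= -!mul_polyC.
  by case: (ltngtP a b) => /= _; rewrite ?polyCD ?polyCM ?polyCB ?polyCN ?polyC1 ?polyC0; ring.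
(* An affine function f satisfies (1 - q) f(-q X) = f(0) - q f((1 - q) X). *)
have : (1 - q) *: rev_char (walk_mx bar_wt) = esym_gf - q *: \prod_i (1 - (q * y i) *: 'X).
  rewrite -eN1 -eN0 eP !HK -!mul_polyC !polyCB !polyCN ?polyC1; ring.
move/(congr1 (fun p : {poly R} => p`_k)); rewrite coefB !coefZ coef_prod_scale -/esym_gf => h.
have q1' : 1 - q != 0 by rewrite subr_eq0 eq_sym.
apply: (mulfI q1'); rewrite h mulrA.
have -> : (1 - q) * \sum_(i < k.+1) q ^+ i = 1 - q ^+ k.+1.
  by have := subrXX 1 q k.+1; rewrite expr1n => ->; congr (_ * _);
     apply: eq_bigr => i _; rewrite expr1n mul1r.
by rewrite mulrBl mul1r exprS mulrA.
Qed.

End WalkDet.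

(** The classical Newton identities are the trace identities of a diagonal matrix. *)
Lemma esym_gf_newton (R : comNzRingType) m (y : 'I_m -> R) k :
  (k.+1)%:R * (\prod_i (1 - y i *: 'X))`_k.+1 =
  - \sum_(i < k.+1) (\prod_i (1 - y i *: 'X))`_(k - i) * \sum_j y j ^+ i.+1.
Proof.
pose A : 'M[R]_m := diag_mx (\row_i y i).
have AX i : A ^+ i = diag_mx (\row_j y j ^+ i).
  elim: i => [|i IH].
    by apply/matrixP => a b; rewrite expr0 !mxE expr0.
  rewrite exprS IH -mulmxE mulmx_diag; congr diag_mx.
  by apply/rowP => j; rewrite !mxE exprS.
have e : rev_char A = \prod_i (1 - y i *: 'X).
  rewrite /rev_char det_trig.
    by apply: eq_bigr => i _; rewrite !mxE eqxx mulrC mul_polyC.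
  apply/is_trig_mxP => i j lij; rewrite !mxE -val_eqE /= (ltn_eqF lij).
  by rewrite mulr0n polyC0 mulr0 subr0.
rewrite -e trace_newton; congr (- _); apply: eq_bigr => i _; congr (_ * _).
by rewrite AX mxtrace_diag; apply: eq_bigr => j _; rewrite mxE.
Qed.

(** * Power sum expansions *)

(** The outer indeterminate records excedances. Coefficients come from rational polynomials in it,
    so that an expansion is the same for every number [m] of variables. *)
Notation emb m := (map_poly (@mpolyC m rat)).

Definition poly_family := forall m : nat, {poly {mpoly rat[m]}}.

(* The parts p.2 need not be sorted, and the same partition may occur several
   times in E. *)
Definition expands N (G : poly_family) (E : seq ({poly rat} * seq nat)) :=
  all (fun p => (0%N \notin p.2) && (sumn p.2 == N)) E /\
  forall m, G m = \sum_(p <- E) emb m p.1 * (psum p.2 m)%:P.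

Definition mul_expansion (E1 E2 : seq ({poly rat} * seq nat)) :=
  [seq (p.1 * p'.1, p.2 ++ p'.2) | p <- E1, p' <- E2].

Lemma expands_mul N1 N2 G1 G2 E1 E2 : expands N1 G1 E1 -> expands N2 G2 E2 ->
  expands (N1 + N2)%N (fun m => G1 m * G2 m) (mul_expansion E1 E2).
Proof.
move=> [a1 h1] [a2 h2]; split.
  apply/allP => _ /allpairsP[[p p'] /= [h1' h2' ->]] /=.
  have /andP[z1 /eqP s1] := allP a1 _ h1'; have /andP[z2 /eqP s2] := allP a2 _ h2'.
  by rewrite mem_cat negb_or z1 z2 sumn_cat s1 s2 eqxx.
move=> m; rewrite h1 h2 big_allpairs_dep big_distrl; apply: eq_bigr => p _ /=.
rewrite big_distrr; apply: eq_bigr => p' _ /=.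
by rewrite rmorphM /psum big_cat /= polyCM mulrACA.
Qed.

Lemma expands_one : expands 0 (fun m => 1) [:: (1, [::])].
Proof.
by split=> // m; rewrite big_seq1 /= rmorph1 /psum big_nil mul1r.
Qed.

Definition expandable N (G : poly_family) := exists E, expands N G E.

Lemma expandable_ext N G G' : (forall m, G m = G' m) -> expandable N G -> expandable N G'.
Proof. by move=> h [E [aE hE]]; exists E; split=> // m; rewrite -h. Qed.

Lemma expandable0 N : expandable N (fun m => 0).
Proof. by exists [::]; split=> // m; rewrite big_nil. Qed.

Lemma expandable1 : expandable 0 (fun m => 1).
Proof. by exists [:: (1, [::])]; apply: expands_one. Qed.

Lemma expandable_add N G1 G2 : expandable N G1 -> expandable N G2 ->
  expandable N (fun m => G1 m + G2 m).
Proof.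
move=> [E1 [a1 h1]] [E2 [a2 h2]]; exists (E1 ++ E2); split=> [|m].
  by rewrite all_cat a1.
by rewrite big_cat h1 h2.
Qed.

Lemma expandable_mul N1 N2 G1 G2 : expandable N1 G1 -> expandable N2 G2 ->
  expandable (N1 + N2)%N (fun m => G1 m * G2 m).
Proof.
by move=> [E1 h1] [E2 h2]; exists (mul_expansion E1 E2); apply: expands_mul.
Qed.

Lemma expandable_scale N c G : expandable N G -> expandable N (fun m => emb m c * G m).
Proof.
have hc : expandable 0 (fun m => emb m c).
  by exists [:: (c, [::])]; split=> // m; rewrite big_seq1 /psum big_nil mulr1.
by move=> h; have := expandable_mul hc h.
Qed.

Lemma expandable_opp N G : expandable N G -> expandable N (fun m => - G m).
Proof.
move/(expandable_scale (-1)); apply: expandable_ext => m.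
by rewrite rmorphN1 mulN1r.
Qed.

Lemma expandable_sub N G1 G2 : expandable N G1 -> expandable N G2 ->
  expandable N (fun m => G1 m - G2 m).
Proof. by move=> h1 /expandable_opp; apply: expandable_add. Qed.

Lemma expandable_sum N (I : eqType) (r : seq I) (P : pred I) (G : I -> poly_family) :
  (forall i, i \in r -> P i -> expandable N (G i)) ->
  expandable N (fun m => \sum_(i <- r | P i) G i m).
Proof.
elim: r => [|a r IH] h.
  by apply: expandable_ext (expandable0 N) => m; rewrite big_nil.
have hr : expandable N (fun m => \sum_(i <- r | P i) G i m).
  by apply: IH => i ir; apply: h; rewrite inE ir orbT.
case Pa: (P a); last by apply: expandable_ext hr => m; rewrite big_cons Pa.
have ha : expandable N (G a) by apply: h; rewrite // inE eqxx.
by apply: expandable_ext (expandable_add ha hr) => m; rewrite big_cons Pa.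
Qed.

Lemma expandable_divn N n G : (0 < n)%N -> expandable N (fun m => n%:R * G m) -> expandable N G.
Proof.
move=> n0 /(expandable_scale (n%:R^-1)%:P); apply: expandable_ext => m.
have -> : n%:R = emb m n%:R by rewrite rmorph_nat.
rewrite mulrA -rmorphM -polyC_natr -polyCM.
by rewrite mulVf ?polyC1 ?rmorph1 ?mul1r // Num.Theory.pnatr_eq0 -lt0n.
Qed.

Lemma expandable_psum k : (0 < k)%N -> expandable k (fun m => (\sum_(i < m) 'X_i ^+ k)%:P).
Proof.
move=> k0; exists [:: (1, [:: k])]; split=> [|m].
  by rewrite /= inE addn0 eqxx andbT eq_sym -lt0n k0.
by rewrite big_seq1 /= rmorph1 mul1r /psum big_seq1.
Qed.

Section Chain.
Variable k : nat.
Hypothesis k0 : (0 < k)%N.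

(** Raising letter weights to the power [k] replaces each variable and the excedance indeterminate
    by their [k]-th powers. *)
Definition yk m (i : 'I_m) : {poly {mpoly rat[m]}} := ('X_i ^+ k)%:P.
Definition qk m : {poly {mpoly rat[m]}} := 'X^k.

Lemma qk_neq1 m : qk m != 1.
Proof.
apply/eqP => /(congr1 (fun p : {poly {mpoly rat[m]}} => p`_k)).
rewrite coefXn eqxx coef1 -[k]prednK //= => /eqP; by rewrite oner_eq0.
Qed.

Lemma qk_emb m i : qk m ^+ i = emb m 'X^(k * i)%N.
Proof. by rewrite rmorphXn /= map_polyX -exprM. Qed.

Lemma yk_sum m n : \sum_j yk j ^+ n = (\sum_(i < m) 'X_i ^+ (k * n)%N)%:P.
Proof. by rewrite rmorph_sum; apply: eq_bigr => j _; rewrite /yk -polyC_exp exprM. Qed.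

(** Induction through Newton's identities; the division by [n.+1] is possible over the rationals. *)
Lemma expandable_esym_gf n : expandable (k * n)%N (fun m => (esym_gf (@yk m))`_n).
Proof.
elim/ltn_ind: n => -[|n] IH.
  rewrite muln0; apply: expandable_ext expandable1 => m.
  rewrite -horner_coef0 /esym_gf horner_prod big1 // => i _.
  by rewrite hornerD hornerN hornerZ hornerX mulr0 subr0 -polyC1 hornerC.
apply: (@expandable_divn _ n.+1) => //.
apply: (@expandable_ext _ (fun m => - \sum_(i < n.+1) (esym_gf (@yk m))`_(n - i)%N *
                               \sum_j yk j ^+ i.+1)) => [m|].
  by rewrite esym_gf_newton.
apply/expandable_opp/expandable_sum => i _ _.
have -> : (k * n.+1 = k * (n - i)%N + k * i.+1)%N.
  by rewrite -mulnDr; congr muln; have := ltn_ord i; lia.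
apply: expandable_mul; first by apply: IH; rewrite ltnS leq_subr.
apply: (@expandable_ext _ (fun m => (\sum_(j < m) 'X_j ^+ (k * i.+1)%N)%:P)) => [m|].
  by rewrite yk_sum.
by apply: expandable_psum; rewrite muln_gt0 k0.
Qed.

Definition Wk m := walk_mx (bar_wt (@yk m) (qk m)).

Lemma expandable_rev_char n : expandable (k * n)%N (fun m => (rev_char (Wk m))`_n).
Proof.
apply: expandable_ext (expandable_scale (\sum_(i < n.+1) 'X^(k * i)%N) (expandable_esym_gf n)) => m.
rewrite rev_char_walk ?qk_neq1 // rmorph_sum; congr (_ * _).
by apply: eq_bigr => i _; rewrite qk_emb.
Qed.

Lemma expandable_trace n : expandable (k * n.+1)%N (fun m => \tr (Wk m ^+ n.+1)).
Proof.
elim/ltn_ind: n => n IH.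
(* The trace identity is solved for its top trace, whose coefficient [rev_char0] is 1. *)
apply: (@expandable_ext _ (fun m => - ((n.+1)%:R * (rev_char (Wk m))`_n.+1) -
   \sum_(i < n) (rev_char (Wk m))`_(n - i)%N * \tr (Wk m ^+ i.+1))) => [m|].
  rewrite trace_newton opprK big_ord_recr /= subnn rev_char0 mul1r.
  by rewrite addrAC subrr add0r.
apply: expandable_sub.
  apply: expandable_opp.
  apply: expandable_ext (expandable_scale (n.+1)%:R (expandable_rev_char n.+1)) => m.
  by rewrite rmorph_nat.
apply: expandable_sum => i _ _.
have -> : (k * n.+1 = k * (n - i)%N + k * i.+1)%N.
  by rewrite -mulnDr; congr muln; have := ltn_ord i; lia.
by apply: expandable_mul; [apply: expandable_rev_char | apply: IH].
Qed.

End Chain.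

Definition letter_wt m (a : letter m) : {poly {mpoly rat[m]}} := ('X_(a.1))%:P * 'X^(a.2).

Lemma letter_wt_exp m k (a : letter m) : letter_wt a ^+ k = bar_wt (@yk k m) (qk k m) a.
Proof. by rewrite /letter_wt /bar_wt /yk /qk exprMn polyC_exp -!exprM mulnC. Qed.

Lemma expandable_closed_sum l r k : (0 < k)%N -> (0 < r)%N -> (r %| l.+1)%N ->
  expandable (r * k)%N (fun m => closed_sum l (@letter_wt m) r k).
Proof.
case: r => // r k0 _ dv; rewrite mulnC.
have hp : expandable (k * r.+1)%N (fun m =>
    emb m 'X^(k * r.+1)%N * (\sum_(i < m) 'X_i ^+ (k * r.+1)%N)%:P).
  by apply/expandable_scale/expandable_psum; rewrite muln_gt0 k0.
apply: expandable_ext (expandable_sub (expandable_trace k0 r) hp) => m.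
rewrite closed_sum_word // /Wk.
under [RHS]eq_bigr => v _.
  rewrite -prodrXl.
  under eq_bigr => j _ do rewrite letter_wt_exp.
  over.
rewrite sum_adm_word; congr (_ - _).
rewrite -qk_emb -yk_sum big_distrr; apply: eq_bigr => a _ /=.
by rewrite /bar_wt /= expr1 exprMn mulrC.
Qed.

(** Closed words of length [r] minus those whose primitive period is a proper divisor of [r], by
    induction on [r]. *)
Lemma expandable_primitive_sum l r k : (0 < k)%N -> (0 < r)%N -> (r %| l.+1)%N ->
  expandable (r * k)%N (fun m => primitive_sum l (@letter_wt m) r k).
Proof.
elim/ltn_ind: r k => r IH k k0 r0 dv.
apply: (@expandable_ext _ (fun m => closed_sum l (@letter_wt m) r k -
   \sum_(d < r | (d %| r)%N) primitive_sum l (@letter_wt m) d (k * (r %/ d))%N)) => [m|].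
  rewrite closed_sum_primitive // big_mkcond big_ord_recr /= dvdnn divnn r0 muln1 -big_mkcond /=.
  by rewrite addrAC subrr add0r.
apply: expandable_sub; first exact: expandable_closed_sum.
apply: expandable_sum => d _ dr; have d0 : (0 < d)%N by apply: dvdn_gt0 dr.
have -> : (r * k = d * (k * (r %/ d)))%N by rewrite mulnCA mulnA mulnC -{1}(divnK dr); lia.
apply: IH => //; last exact: dvdn_trans dr dv.
by rewrite muln_gt0 k0 divn_gt0 // dvdn_leq.
Qed.

(** Induction on [M]: the Newton recursion is divided by [r * M]. *)
Lemma expandable_period_sum l B r M : (r * M <= B)%N -> (0 < r)%N -> (r %| l.+1)%N ->
  expandable (r * M)%N (fun m => period_sum l B (@letter_wt m) r M).
Proof.
move=> + r0 dv; elim/ltn_ind: M => -[|M] IH rB.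
  by rewrite muln0; apply: expandable_ext expandable1 => m; rewrite period_sum0.
apply: (@expandable_divn _ (r * M.+1)%N); first by rewrite muln_gt0 r0.
apply: (@expandable_ext _ (fun m => \sum_(1 <= k < M.+2) primitive_sum l (@letter_wt m) r k *
   period_sum l B (@letter_wt m) r (M.+1 - k)%N)) => [m|]; first by rewrite period_sum_newton.
apply: expandable_sum => k; rewrite mem_index_iota => /andP[k1 kM] _.
have -> : (r * M.+1 = r * k + r * (M.+1 - k)%N)%N.
  by rewrite -mulnDr; congr muln; lia.
apply: expandable_mul; first exact: expandable_primitive_sum.
apply: IH; first by lia.
by apply: leq_trans rB; rewrite leq_mul2l leq_subr orbT.
Qed.

(** The index [j = N] contributes only when [N = 0]; including it covers that case. *)
Definition Qt N la : poly_family := fun m => \sum_(j < N.+1) (Qsym N la j m)%:P * 'X^j.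

Lemma exc_ltn N (s : 'S_N) : (0 < N)%N -> (exc s < N)%N.
Proof.
case: N s => // N s _; rewrite /exc -[X in (_ < X)%N]card_ord -cardsT.
apply: proper_card; apply/properP; split; first exact: subsetT.
by exists ord_max => //; rewrite inE -leqNgt -ltnS.
Qed.

Lemma Qt_walk N la m : Qt N la m =
  \sum_(s : 'S_N | cycle_type s == la)
     \sum_(c : {ffun 'I_N -> 'I_m} | compat s c) \prod_i letter_wt (lett s c i).
Proof.
have exc_le (s : 'S_N) : (exc s < N.+1)%N.
  by rewrite ltnS -[X in (_ <= X)%N]card_ord; apply: max_card.
rewrite [RHS](partition_big (fun s => Ordinal (exc_le s)) predT) //=.
apply: eq_bigr => j _; rewrite /Qsym rmorph_sum big_distrl /=.
apply: eq_big => // s /andP[_ /eqP es].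
rewrite /Fqsym rmorph_sum big_distrl /=; apply: eq_bigr => c _.
rewrite /letter_wt big_split /= -rmorph_prod; congr (_ * _).
rewrite prodrXr -es; congr ('X ^+ _); rewrite /exc -sum1_card big_mkcond /=.
by apply: eq_bigr => i _; rewrite inE; case: ifP.
Qed.

Lemma Qt_prod N la B l m : is_partn N la -> (N <= B)%N ->
  (forall r, r \in la -> (r %| l.+1)%N) ->
  Qt N la m = \prod_(r < l.+2) period_sum l B (@letter_wt m) r (mult r la).
Proof. by move=> h1 h2 h3; rewrite Qt_walk (sum_compat_mults _ h1 h2 h3) necklace_mults_prod. Qed.

Lemma is_partn_nseq r M : (0 < r)%N -> is_partn (r * M)%N (nseq M r).
Proof.
move=> r0; rewrite /is_partn sumn_nseq eqxx andbT; apply/andP; split.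
  by elim: M => //= -[|M] //= h; rewrite h /geq /= leqnn.
by rewrite mem_nseq negb_and eq_sym -lt0n r0 orbT.
Qed.

(** All periods other than [r] have multiplicity 0 and contribute a factor 1. *)
Lemma Qt_nseq r M B l m : (0 < r)%N -> (r * M <= B)%N -> (r %| l.+1)%N ->
  Qt (r * M)%N (nseq M r) m = period_sum l B (@letter_wt m) r M.
Proof.
move=> r0 rB dv; rewrite (@Qt_prod _ _ B l) ?is_partn_nseq //; last first.
  by move=> x; rewrite mem_nseq => /andP[_ /eqP ->].
have rl : (r < l.+2)%N by rewrite ltnS dvdn_leq.
rewrite (bigD1 (Ordinal rl)) //= /mult count_nseq /= eqxx mul1n big1 ?mulr1 //.
move=> i; rewrite -val_eqE /= => /negbTE ne.
by rewrite count_nseq /= eq_sym ne mul0n period_sum0.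
Qed.

Lemma mem_le_sumn s x : x \in s -> (x <= sumn s)%N.
Proof. by elim: s => //= a s IH; rewrite inE => /orP[/eqP ->|/IH]; lia. Qed.

Lemma part_le n la r : is_partn n la -> r \in la -> (r <= n)%N.
Proof. by case/and3P=> _ _ /eqP <-; apply: mem_le_sumn. Qed.

Lemma part_dvd_fact n la r : is_partn n la -> r \in la -> (r %| n`!)%N.
Proof.
move=> pla hr; apply: dvdn_fact; rewrite (part_le pla hr) andbT lt0n.
by case/and3P: pla => _ z _; apply: contraNneq z => <-.
Qed.

Lemma mult_le n la r : is_partn n la -> (r * mult r la <= n)%N.
Proof.
case/and3P=> _ _ /eqP <-; rewrite /mult.
elim: la => [|a la IH] /=; first by rewrite muln0.
by rewrite mulnDr; apply: leq_add => //; case: eqP => [->|_]; rewrite ?muln1 ?muln0.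
Qed.

(** With words of length n!, which every part divides, both sides are products of the same period
    sums. *)
Lemma Qt_factor n la m : is_partn n la ->
  Qt n la m = \prod_(1 <= r < n.+1)
    if mult r la == 0%N then 1 else Qt (r * mult r la)%N (nseq (mult r la) r) m.
Proof.
move=> pla; have [l el] : exists l, l.+1 = n`!.
  by exists (n`!.-1); rewrite prednK // fact_gt0.
rewrite (@Qt_prod _ _ n l) //; last by move=> r /(part_dvd_fact pla); rewrite el.
have F0 r : mult r la = 0%N -> period_sum l n (@letter_wt m) r (mult r la) = 1.
  by move=> ->; rewrite period_sum0.
have m0 : mult 0 la = 0%N by case/and3P: pla => _ /count_memPn.
have nl : (n.+1 <= l.+2)%N.
  by rewrite ltnS el; case: (n) => // k; rewrite factS leq_pmulr ?fact_gt0.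
rewrite -(big_mkord predT (fun r => period_sum l n (@letter_wt m) r (mult r la))).
rewrite (@big_cat_nat _ _ _ n.+1) //= [X in _ * X]big_nat [X in _ * X]big1 ?mulr1; last first.
  move=> r /andP[hr _]; apply: F0; apply/count_memPn; apply/negP => /(part_le pla); lia.
rewrite big_ltn // F0 // mul1r !big_nat; apply: eq_bigr => r /andP[r1 rn].
case: eqP => [/F0//|/eqP ne]; rewrite (@Qt_nseq r (mult r la) n l) ?mult_le //.
rewrite el; apply: part_dvd_fact (pla) _.
by rewrite -has_pred1 has_count lt0n.
Qed.

Lemma expandable_Qt_nseq r M : (0 < r)%N -> expandable (r * M)%N (Qt (r * M)%N (nseq M r)).
Proof.
move=> r0; apply: (@expandable_ext _ (fun m =>
  period_sum r.-1 (r * M)%N (@letter_wt m) r M)) => [m|].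
  by rewrite (@Qt_nseq r M (r * M)%N r.-1) // prednK.
by apply: expandable_period_sum; rewrite ?prednK.
Qed.

Import Num.Theory.

(** * Uniqueness of the expansion *)

Section PsumCoef.
Variables (mu : seq nat) (m : nat).

(** The monomial obtained by choosing the variable [phi t] in the factor of the part [t] of [mu]. *)
Definition psum_mon (phi : {ffun 'I_(size mu) -> 'I_m}) : 'X_{1..m} :=
  (\sum_t U_(phi t) *+ nth 0%N mu t)%MM.

Lemma psum_monE phi j : psum_mon phi j = (\sum_(t | phi t == j) nth 0%N mu t)%N.
Proof.
rewrite /psum_mon mnm_sumE [RHS]big_mkcond; apply: eq_bigr => t _.
by rewrite mulmnE mnm1E; case: eqP => _; rewrite ?mul1n ?mul0n.
Qed.

Lemma mcoeff_psum mon : (psum mu m)@_mon = (\sum_phi (psum_mon phi == mon))%:R.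
Proof.
have -> : psum mu m = \sum_phi 'X_[psum_mon phi].
  rewrite /psum (big_nth 0%N) big_mkord.
  rewrite (bigA_distr_bigA (fun (t : 'I_(size mu)) (i : 'I_m) =>
    ('X_i : {mpoly rat[m]}) ^+ nth 0%N mu t)).
  apply: eq_bigr => phi _; rewrite /psum_mon.
  rewrite (big_morph (fun x => 'X_[x] : {mpoly rat[m]}) (@mpolyXD _ _) (@mpolyX0 _ _)).
  by apply: eq_bigr => t _; rewrite mpolyXn.
rewrite raddf_sum natr_sum; apply: eq_bigr => phi _ /=.
by rewrite mcoeffX.
Qed.

End PsumCoef.

Definition part_mon (nu : seq nat) : 'X_{1..size nu} := [multinom nth 0%N nu i | i < size nu].

Lemma part_mon_psum nu : (psum nu (size nu))@_(part_mon nu) != 0.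
Proof.
rewrite mcoeff_psum pnatr_eq0 -lt0n (bigD1 [ffun i => i]) //=.
suff -> : psum_mon [ffun i => i] == part_mon nu by [].
apply/eqP/mnmP => j; rewrite psum_monE mnmE (big_pred1 j) // => i.
by rewrite ffunE.
Qed.

(** The parts of [nu] must be sums over the fibers of some [phi]. They are nonzero, so [phi] is
    surjective, and the bound on sizes makes it a bijection. *)
Lemma part_mon_psum_neq N mu nu : is_partn N mu -> is_partn N nu ->
  (psum mu (size nu))@_(part_mon nu) != 0 -> (size mu <= size nu)%N -> mu = nu.
Proof.
move=> /and3P[smu _ _] /and3P[snu znu _].
rewrite mcoeff_psum pnatr_eq0 sum_nat_eq0 negb_forall => /existsP[phi].
rewrite implyTb eqb0 negbK => /eqP/mnmP hphi szmn.
have surj j : exists t, phi t == j.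
  have [/existsP//|/existsPn h] := boolP [exists t, phi t == j].
  have := hphi j; rewrite psum_monE big1 => [|t e]; last by rewrite (negbTE (h t)) in e.
  by rewrite mnmE => e; move: znu; rewrite e mem_nth.
have ch j : phi (xchoose (surj j)) = j by apply/eqP; apply: xchooseP (surj j).
have inj : injective phi.
  have gi : injective (fun j => xchoose (surj j)) by apply: can_inj ch.
  have gb := inj_card_bij gi; rewrite !card_ord in gb.
  exact: bij_inj (bij_can_bij (gb szmn) ch).
apply: (sorted_eq geq_trans geq_anti) => //.
have e1 : mu = [seq nth 0%N nu (val j) | j <- [seq phi t | t <- enum 'I_(size mu)]].
  rewrite -[LHS](mkseq_nth 0%N) /mkseq -val_enum_ord -!map_comp; apply: eq_map => t /=.
  have := hphi (phi t); rewrite psum_monE mnmE (big_pred1 t) // => i.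
  by rewrite (inj_eq inj).
have e2 : nu = [seq nth 0%N nu (val j) | j <- enum 'I_(size nu)].
  by rewrite -[LHS](mkseq_nth 0%N) /mkseq -val_enum_ord -map_comp.
have : perm_eq [seq phi t | t <- enum 'I_(size mu)] (enum 'I_(size nu)).
  apply: uniq_perm; [by rewrite map_inj_uniq ?enum_uniq|exact: enum_uniq|move=> j].
  rewrite mem_enum; apply/mapP; exists (xchoose (surj j)); first by rewrite mem_enum.
  by rewrite ch.
by move/(perm_map (fun j : 'I__ => nth 0%N nu (val j))); rewrite -e1 -e2.
Qed.

(* By descending induction on the length: if mu is not longer than nu, then x^nu
   occurs in p_mu only for mu = nu. *)
Lemma psum_indep N (c : seq nat -> rat) :
  (forall m, \sum_(nu : {bseq N of 'I_N.+1} | is_partn N (map val nu))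
               c (map val nu) *: psum (map val nu) m = 0) ->
  forall nu : {bseq N of 'I_N.+1}, is_partn N (map val nu) -> c (map val nu) = 0.
Proof.
move=> h; suff H n (nu : {bseq N of 'I_N.+1}) :
  (N - size nu <= n)%N -> is_partn N (map val nu) -> c (map val nu) = 0.
  by move=> nu; apply: (H N); apply: leq_subr.
elim/ltn_ind: n nu => n IH nu hn pnu.
have /(congr1 (mcoeff (part_mon (map val nu)))) := h (size (map val nu)).
rewrite mcoeff0 raddf_sum /= (bigD1 nu) //= big1 ?addr0.
  by rewrite mcoeffZ => /eqP; rewrite mulf_eq0 (negbTE (part_mon_psum _)) orbF => /eqP.
move=> mu /andP[pmu ne]; rewrite mcoeffZ.
have [e|ne0] := eqVneq ((psum (map val mu) (size (map val nu)))@_(part_mon (map val nu))) 0.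
  by rewrite e mulr0.
have [lt|le] := ltnP (size nu) (size mu).
  by rewrite (IH (N - size mu)%N) ?mul0r //; have := size_bseq mu; lia.
have e : map val mu = map val nu.
  by apply: part_mon_psum_neq pmu pnu ne0 _; rewrite !size_map.
case/eqP: ne; apply: val_inj; exact: inj_map (@val_inj _ _ _) _ _ e.
Qed.

Lemma zpart_neq0 nu : (zpart nu)%:R != 0 :> rat.
Proof.
rewrite pnatr_eq0 -lt0n /zpart big_nat prodn_cond_gt0 // => i /andP[i1 _].
by rewrite muln_gt0 fact_gt0 expn_gt0 i1.
Qed.

Lemma size_le_sumn s : 0%N \notin s -> (size s <= sumn s)%N.
Proof.
elim: s => //= a s IH; rewrite inE negb_or => /andP[a0 /IH]; lia.
Qed.

Lemma partn_bseq N s : 0%N \notin s -> sumn s = N ->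
  exists nu : {bseq N of 'I_N.+1}, map val nu = s.
Proof.
move=> z e.
have sz : (size [seq inord x : 'I_N.+1 | x <- s] <= N)%N by rewrite size_map -e size_le_sumn.
exists (Bseq sz) => /=; rewrite -map_comp -[RHS]map_id; apply/eq_in_map => x xs /=.
by rewrite inordK // ltnS -e mem_le_sumn.
Qed.

Lemma psum_expansion_unique N F c c' nu :
  psum_expansion N F c -> psum_expansion N F c' -> is_partn N nu -> c nu = c' nu.
Proof.
move=> h h' pnu; have [_ z /eqP sm] := and3P pnu.
have [b eb] := partn_bseq z sm.
pose e s := c s / (zpart s)%:R - c' s / (zpart s)%:R.
have e0 : e nu = 0.
  rewrite -eb; apply: (@psum_indep N) => [m|]; last by rewrite eb.
  under eq_bigr do rewrite scalerBl.
  by rewrite sumrB -h -h' subrr.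
move: e0; rewrite /e -mulrBl => /eqP; rewrite mulf_eq0 subr_eq0 invr_eq0.
by rewrite (negbTE (zpart_neq0 _)) orbF => /eqP.
Qed.

Lemma chiE N F c nu : psum_expansion N F c -> is_partn N nu -> chi N F nu = c nu.
Proof.
move=> h; apply: psum_expansion_unique (h).
exact: (epsilon_spec (inhabits (fun _ : seq nat => 0 : rat)) _ (ex_intro _ c h)).
Qed.

Lemma perm_psum s s' m : perm_eq s s' -> psum s m = psum s' m.
Proof. by move=> h; rewrite /psum (perm_big s'). Qed.

(** Terms are grouped by the sorted form of [p.2], and [zpart nu] cancels the normalization in
    [psum_expansion]. *)
Lemma expands_coef N G E j : expands N G E ->
  psum_expansion N (fun m => (G m)`_j)
    (fun nu => (zpart nu)%:R * \sum_(p <- E | sort geq p.2 == nu) (p.1)`_j).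
Proof.
case=> aE hE m; rewrite hE coef_sum.
under [RHS]eq_bigr => nu _.
  rewrite mulrC mulKf ?zpart_neq0 // scaler_suml big_mkcond; over.
rewrite exchange_big /= big_seq [RHS]big_seq; apply: eq_bigr => p pE.
have /andP[z /eqP sp] := allP aE _ pE.
have zs : 0%N \notin sort geq p.2 by rewrite mem_sort.
have ss : sumn (sort geq p.2) = N by rewrite -sp; apply/perm_sumn; rewrite perm_sort.
have [b eb] := partn_bseq zs ss.
rewrite (bigD1 b) /=; last first.
  by rewrite /is_partn eb ss eqxx zs (sort_sorted geq_total).
rewrite eb eqxx big1 ?addr0 => [|nu /andP[_ ne]].
  rewrite coefMC coef_map /= mul_mpolyC; congr (_ *: _).
  by apply: perm_psum; rewrite perm_sym perm_sort.
case: eqP => // e; case/eqP: ne; apply: val_inj.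
by apply: (inj_map (@val_inj _ _ _)); rewrite eb.
Qed.

(** * The coefficients at rectangular partitions *)

Section Rectangular.
Variable d : nat.
Hypothesis d0 : (0 < d)%N.

(** The coefficient of the power sum of the rectangle with parts [d]; the value 0 reflects that no
    such rectangle has size [N] unless [d] divides [N]. *)
Definition rect_coef N (E : seq ({poly rat} * seq nat)) : {poly rat} :=
  if (d %| N)%N then \sum_(p <- E | p.2 == nseq (N %/ d) d) p.1 else 0.

Lemma sort_nseq s k : (sort geq s == nseq k d) = (s == nseq k d).
Proof.
apply/eqP/eqP => [e|->]; last first.
  apply: (sorted_eq geq_trans geq_anti); last by rewrite perm_sort.
    exact: sort_sorted geq_total _.
  by have /and3P[] := is_partn_nseq k d0.
have p : perm_eq s (nseq k d) by rewrite -e perm_sym perm_sort.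
rewrite -(size_nseq k d) -(perm_size p); apply/all_pred1P.
by rewrite (perm_all _ p); apply/all_pred1P; rewrite size_nseq.
Qed.

(** A concatenation has all parts equal to [d] exactly when both pieces do, so no other terms
    contribute. *)
Lemma rect_coef_mul N1 N2 G1 G2 E1 E2 : expands N1 G1 E1 -> expands N2 G2 E2 ->
  rect_coef (N1 + N2)%N (mul_expansion E1 E2) = rect_coef N1 E1 * rect_coef N2 E2.
Proof.
move=> [/allP a1 _] [/allP a2 _]; rewrite /rect_coef.
have key p p' : p \in E1 -> p' \in E2 -> (d %| N1 + N2)%N ->
  (p.2 ++ p'.2 == nseq ((N1 + N2) %/ d) d) =
  [&& (d %| N1)%N, p.2 == nseq (N1 %/ d) d & p'.2 == nseq (N2 %/ d) d].
  move=> /a1/andP[_ /eqP s1] /a2/andP[_ /eqP s2] dv; apply/idP/idP.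
    move=> /eqP e; have : all (pred1 d) (p.2 ++ p'.2).
      by rewrite e; apply/all_pred1P; rewrite size_nseq.
    rewrite all_cat => /andP[/all_pred1P e1 /all_pred1P e2].
    have n1 : N1 = (d * size p.2)%N by rewrite -s1 e1 sumn_nseq size_nseq.
    have n2 : N2 = (d * size p'.2)%N by rewrite -s2 e2 sumn_nseq size_nseq.
    by rewrite n1 n2 dvdn_mulr //= !mulKn // -e1 -e2 !eqxx.
  case/and3P=> d1 /eqP -> /eqP ->; rewrite -nseqD divnDl //.
case: (boolP (d %| N1 + N2)%N) => [dv|ndv]; last first.
  case d1: (d %| N1)%N; last by rewrite mul0r.
  by case d2: (d %| N2)%N; rewrite ?mulr0 //; rewrite dvdn_add in ndv.
rewrite big_mkcond big_allpairs_dep /=.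
case d1: (d %| N1)%N; last first.
  rewrite mul0r big_seq big1 // => p pE; rewrite big_seq big1 // => p' pE'.
  by rewrite key // d1.
have -> : (d %| N2)%N by rewrite -(dvdn_addr _ d1).
rewrite big_distrl /= [RHS]big_mkcond /= big_seq [RHS]big_seq; apply: eq_bigr => p pE.
case E: (p.2 == nseq (N1 %/ d) d).
  rewrite big_distrr [RHS]big_mkcond big_seq [RHS]big_seq; apply: eq_bigr => p' pE' /=.
  by rewrite key // d1 E.
by rewrite big_seq big1 // => p' pE'; rewrite key // d1 E.
Qed.

Lemma is_partn_rect k : is_partn (k * d)%N (nseq k d).
Proof. by rewrite mulnC is_partn_nseq. Qed.

Lemma Qt_coef N la j m : (0 < N)%N ->
  (Qt N la m)`_j = if (j < N)%N then Qsym N la j m else 0.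
Proof.
move=> N0; rewrite /Qt.
have -> : \sum_(j < N.+1) (Qsym N la j m)%:P * 'X^j = \poly_(j < N.+1) Qsym N la j m.
  by rewrite poly_def; apply: eq_bigr => i _; rewrite mul_polyC.
rewrite coef_poly ltnS leq_eqVlt; case: ltnP => h; rewrite ?orbT // orbF.
case: eqP => // e; rewrite /Qsym big1 // => s /andP[_ /eqP es].
by have := exc_ltn s N0; rewrite es e ltnn.
Qed.

Lemma chi_rect N k la E j : N = (k * d)%N -> (0 < N)%N -> expands N (Qt N la) E ->
  (zpart (nseq k d))%:R * (rect_coef N E)`_j =
  if (j < N)%N then chi N (Qsym N la j) (nseq k d) else 0.
Proof.
move=> eN N0 hE.
have pk : is_partn N (nseq k d) by rewrite eN is_partn_rect.
have rE : (zpart (nseq k d))%:R * (rect_coef N E)`_j =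
    (zpart (nseq k d))%:R * \sum_(p <- E | sort geq p.2 == nseq k d) (p.1)`_j.
  congr (_ * _); rewrite /rect_coef eN dvdn_mull // mulnK // coef_sum.
  by apply: eq_bigl => p; rewrite sort_nseq.
have := expands_coef j hE => hc; rewrite rE.
case: ifP => jN.
  have hc' : psum_expansion N (Qsym N la j) (fun nu =>
      (zpart nu)%:R * \sum_(p <- E | sort geq p.2 == nu) (p.1)`_j).
    by move=> m; rewrite -hc Qt_coef // jN.
  by rewrite (chiE hc' pk).
(* For [j] at least [N] the coefficient is the zero series, which the zero function expands. *)
apply: (psum_expansion_unique (c' := fun=> 0) hc _ pk) => m.
rewrite Qt_coef // jN big1 // => nu _.
by rewrite mul0r scale0r.
Qed.

Lemma chi_poly N k la E : N = (k * d)%N -> (0 < N)%N -> expands N (Qt N la) E ->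
  \sum_(0 <= j < N) chi N (Qsym N la j) (nseq k d) *: 'X^j =
  (zpart (nseq k d))%:R *: rect_coef N E.
Proof.
move=> eN N0 hE; rewrite big_mkord -(poly_def N (fun j => chi N (Qsym N la j) (nseq k d))).
by apply/polyP => j; rewrite coef_poly coefZ (chi_rect j eN N0 hE).
Qed.

Lemma expands_prod (s : seq nat) (N_ : nat -> nat) (G_ : nat -> poly_family)
    (g : nat -> {poly rat}) :
  (forall r, r \in s -> exists2 E, expands (N_ r) (G_ r) E & rect_coef (N_ r) E = g r) ->
  exists2 E, expands (\sum_(r <- s) N_ r) (fun m => \prod_(r <- s) G_ r m) E &
             rect_coef (\sum_(r <- s) N_ r) E = \prod_(r <- s) g r.
Proof.
elim: s => [|r s IH] h.
  exists [:: (1, [::])].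
    split; first by rewrite big_nil.
    by move=> m; rewrite big_nil; case: expands_one => _ ->.
  by rewrite /rect_coef !big_nil dvdn0 div0n big_mkcond big_seq1.
have [E1 h1 e1] := h r (mem_head _ _).
have [|E2 h2 e2] := IH; first by move=> x xs; apply: h; rewrite inE xs orbT.
exists (mul_expansion E1 E2).
  have := expands_mul h1 h2; rewrite big_cons => -[a b]; split=> // m.
  by rewrite big_cons b.
by rewrite !big_cons (rect_coef_mul h1 h2) e1 e2.
Qed.

Lemma zpart_rect k : zpart (nseq k d) = (d ^ k * k`!)%N.
Proof.
case: k => [|k]; first by rewrite /zpart big_geq.
rewrite /zpart sumn_nseq (big_cat_nat (n := d)) ?leqW ?leq_pmulr //= big_nat.
rewrite big1 => [|i /andP[_ hi]]; last first.
  by rewrite /mult count_nseq /= (gtn_eqF hi).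
rewrite mul1n big_ltn ?ltnS ?leq_pmulr // big_nat big1 => [|i /andP[hi _]]; last first.
  by rewrite /mult count_nseq /= (ltn_eqF hi).
by rewrite muln1 /mult count_nseq /= eqxx mul1n.
Qed.

End Rectangular.

(** Integrality of multinomial coefficients, as products of binomial ones; it makes the truncated
    division in [multinomial_coef] exact. *)
Lemma prod_fact_dvd (I : Type) (s : seq I) (f : I -> nat) :
  (\prod_(i <- s) (f i)`! %| (\sum_(i <- s) f i)`!)%N.
Proof.
elim: s => [|a s IH]; first by rewrite !big_nil.
rewrite !big_cons; have := bin_fact (leq_addr (\sum_(j <- s) f j) (f a)).
by rewrite addKn => <-; rewrite dvdn_mull // dvdn_mul.
Qed.

Lemma sum_mult_iota n la : is_partn n la ->
  (\sum_(1 <= r < n.+1) r * mult r la)%N = n.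
Proof.
move=> pla; have /and3P[_ _ /eqP e] := pla.
rewrite -{2}e -(@sumn_mult n.+1 la) => [|r /(part_le pla)//].
by rewrite -(big_mkord predT (fun r => (r * mult r la)%N)) [RHS]big_ltn // mul0n.
Qed.

Section Final.
Variables (n k d : nat) (la : seq nat).
Hypotheses (hla : is_partn n la) (hd : (0 < d)%N) (hn : n = (k * d)%N).

Let Nr r := (r * mult r la)%N.
Let Sr r := \sum_(0 <= j < Nr r) chi (Nr r) (Qsym (Nr r) (nseq (mult r la) r) j)
                 (nseq (Nr r %/ d) d) *: 'X^j : {poly rat}.

(** The rectangular coefficient of the factor with parts [r], recovered from its characters by
    dividing by [zpart]. *)
Definition rect_factor r : {poly rat} :=
  if mult r la == 0%N then 1 else
  if (d %| Nr r)%N then (zpart (nseq (Nr r %/ d) d))%:R^-1 *: Sr r else 0.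

Lemma Qt_rect_factor : exists2 E, expands n (Qt n la) E &
  rect_coef d n E = \prod_(1 <= r < n.+1) rect_factor r.
Proof.
have [r|E [aE hE] e] := @expands_prod d hd (index_iota 1 n.+1) Nr
  (fun r m => if mult r la == 0%N then 1 else Qt (Nr r) (nseq (mult r la) r) m) rect_factor.
  rewrite mem_index_iota => /andP[r1 _]; rewrite /rect_factor.
  case: eqP => [m0|/eqP m0].
    exists [:: (1, [::])]; first by rewrite /Nr m0 muln0; apply: expands_one.
    by rewrite /rect_coef /Nr m0 muln0 dvdn0 div0n big_mkcond big_seq1.
  have [E hE] := expandable_Qt_nseq (mult r la) r1; exists E => //.
  case: ifP => [dv|ndv]; last by rewrite /rect_coef -/(Nr r) ndv.
  have N0 : (0 < Nr r)%N by rewrite muln_gt0 r1 lt0n.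
  have eN : Nr r = (Nr r %/ d * d)%N by rewrite divnK.
  rewrite /Sr (chi_poly hd eN N0 hE) scalerA mulVf ?scale1r //.
  exact: zpart_neq0.
move: aE hE e; rewrite /Nr sum_mult_iota // => aE hE e; exists E => //; split=> // m.
by rewrite Qt_factor.
Qed.

Lemma rect_factor_not_dvd r : (1 <= r <= n)%N -> ~~ (d %| Nr r)%N ->
  \prod_(1 <= r < n.+1) rect_factor r = 0.
Proof.
move=> /andP[r1 rn] nd; rewrite (big_rem r) /=; last by rewrite mem_index_iota r1 ltnS.
rewrite {1}/rect_factor (negbTE nd); case: eqP => [m0|]; last by rewrite mul0r.
by rewrite /Nr m0 muln0 dvdn0 in nd.
Qed.

(** The heights of the small rectangles add up to [k], so the powers of [d] agree and only
    factorials remain. *)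
Lemma zpart_multinomial : (forall r, (1 <= r <= n)%N -> (d %| Nr r)%N) ->
  zpart (nseq k d) = (multinomial_coef (n %/ d) [seq (Nr r) %/ d | r <- index_iota 1 n.+1]
    * \prod_(1 <= r < n.+1) zpart (nseq (Nr r %/ d) d))%N.
Proof.
move=> dv; have sk : (\sum_(1 <= r < n.+1) Nr r %/ d)%N = k.
  apply/eqP; rewrite -(eqn_pmul2r hd) -hn -{2}(sum_mult_iota hla) big_distrl /= !big_nat.
  by apply/eqP; apply: eq_bigr => r /dv h; rewrite divnK.
under [in RHS]eq_bigr do rewrite zpart_rect //.
rewrite zpart_rect // big_split /= -expn_sum sk mulnCA; congr (_ * _)%N.
have nd : (n %/ d)%N = k by rewrite hn mulnK.
rewrite /multinomial_coef big_map nd divnK // -[X in (_ %| X`!)%N]sk.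
exact: prod_fact_dvd.
Qed.

End Final.

Theorem theorem5p3 (n k d : nat) (la : seq nat)
    (hla : is_partn n la) (hk : (0 < k)%N) (hd : (0 < d)%N)
    (hn : n = (k * d)%N) :
  ((exists r : nat, (1 <= r <= n)%N /\ ~~ (d %| r * mult r la)%N) ->
     forall j : nat, (0 <= j <= n - 1)%N ->
       chi n (Qsym n la j) (nseq k d) = 0)
  /\
  ((forall r : nat, (1 <= r <= n)%N -> (d %| r * mult r la)%N) ->
     \sum_(0 <= j < n) chi n (Qsym n la j) (nseq k d) *: 'X^j =
     (multinomial_coef (n %/ d)
        [seq (r * mult r la) %/ d | r <- index_iota 1 n.+1])%N%:R
     * \prod_(1 <= r < n.+1)
         (if mult r la == 0%N then 1 else
          \sum_(0 <= j < r * mult r la)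
             chi (r * mult r la) (Qsym (r * mult r la) (nseq (mult r la) r) j)
                 (nseq (r * mult r la %/ d) d) *: 'X^j)
     :> {poly rat}).
Proof.
have n0 : (0 < n)%N by rewrite hn muln_gt0 hk.
have [E hE e] := Qt_rect_factor hla hd; split.
  (* The character is a multiple of a coefficient of a product that has a zero factor. *)
  move=> [r [hr nd]] j /andP[_ hj].
  have jn : (j < n)%N by lia.
  have := chi_rect hd j hn n0 hE; rewrite jn => <-.
  by rewrite e (rect_factor_not_dvd hr nd) coef0 mulr0.
(* Each [zpart] split off from that of the large rectangle cancels the inverse in the matching
   [rect_factor]. *)
move=> dv; rewrite (chi_poly hd hn n0 hE) e (zpart_multinomial hla hd hn dv).
rewrite natrM natr_prod -scalerA scaler_nat mulr_natl; congr (_ *+ _).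
rewrite -mul_polyC rmorph_prod -big_split /= !big_nat; apply: eq_bigr => r hr.
rewrite /rect_factor; case: eqP => [->|_].
  by rewrite muln0 div0n mulr1 /zpart big_geq.
by rewrite dv // mul_polyC scalerA divff ?scale1r // zpart_neq0.
Qed.
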